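(* Let $C:\mathbb{Z}^6\to\mathbb{Z}$ be the function defined below, encoding the Littlewood--Richardson coefficients associated to $SL_3$, and call a \emph{linear symmetry} of $C$ any invertible linear map $F:\mathbb{Z}^6\to\mathbb{Z}^6$ (i.e. $F\in GL_6(\mathbb{Z})$) such that $C\circ F=C$. Then the group of linear symmetries of $C$ has order $144$ and is isomorphic to $\mathfrak{S}_2\times(\mathfrak{S}_3\wr\mathfrak{S}_2)$, where $\mathfrak{S}_3\wr\mathfrak{S}_2$ denotes the wreath product (the group of permutations of a $6$-element set partitioned into two blocks of size $3$ that stabilize or swap the two blocks). This group acts transitively on the $18$ chambers $\kappa_1,\dots,\kappa_{18}$ of the chamber complex described below. Moreover, it is generated by the group of order $12$ generated by the known symmetries $S,T,U$ described below, together with the additional symmetry $X$ given by \[ X(\lambda_1,\lambda_2,\mu_1,\mu_2,\nu_1,\nu_2)=(\lambda_1+\mu_1-\nu_2,\ \lambda_2+\mu_1-\nu_2,\ \nu_2,\ \mu_2,\ \nu_1,\ \mu_1), \] i.e. for all integers, \[ c^{(\nu_1,\nu_2,\nu_3)}_{(\lambda_1,\lambda_2),(\mu_1,\mu_2)}=c^{(\nu_1,\mu_1,\nu_3)}_{(\lambda_1+\mu_1-\nu_2,\ \lambda_2+\mu_1-\nu_2),(\nu_2,\mu_2)}. \]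
   Context: For partitions $\lambda,\mu,\nu$, $c^{\nu}_{\lambda,\mu}$ denotes the Littlewood--Richardson coefficient (multiplicity of the irreducible polynomial $GL$-representation of highest weight $\nu$ in the tensor product of those of highest weights $\lambda$ and $\mu$; equivalently the coefficient of the Schur function $s_\nu$ in $s_\lambda s_\mu$); it is $0$ unless $|\nu|=|\lambda|+|\mu|$. Define $C:\mathbb{Z}^6\to\mathbb{Z}$ with coordinates $(\lambda_1,\lambda_2,\mu_1,\mu_2,\nu_1,\nu_2)$ as follows: set $\nu_3=\lambda_1+\lambda_2+\mu_1+\mu_2-\nu_1-\nu_2$; if $\lambda_1\ge\lambda_2\ge0$, $\mu_1\ge\mu_2\ge0$ and $\nu_1\ge\nu_2\ge\nu_3\ge0$ then $C(\lambda_1,\lambda_2,\mu_1,\mu_2,\nu_1,\nu_2)=c^{(\nu_1,\nu_2,\nu_3)}_{(\lambda_1,\lambda_2),(\mu_1,\mu_2)}$, and otherwise $C=0$. (In the displayed identity of the claim, $\nu_3$ is given by this formula.) Known symmetries (throughout, $\nu_3=\lambda_1+\lambda_2+\mu_1+\mu_2-\nu_1-\nu_2$): $S(\lambda_1,\lambda_2,\mu_1,\mu_2,\nu_1,\nu_2)=(\mu_1,\mu_2,\lambda_1,\lambda_2,\nu_1,\nu_2)$; $U(\lambda_1,\lambda_2,\mu_1,\mu_2,\nu_1,\nu_2)=(\nu_1-\nu_3,\ \nu_1-\nu_2,\ \mu_1,\ \mu_2,\ \nu_1,\ \nu_1-\lambda_2)$; $T(\lambda_1,\lambda_2,\mu_1,\mu_2,\nu_1,\nu_2)=(\lambda_1,\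 \lambda_1-\lambda_2,\ \mu_1,\ \mu_1-\mu_2,\ \lambda_1+\mu_1-\nu_3,\ \lambda_1+\mu_1-\nu_2)$. These are linear symmetries of $C$ generating a group of order $12$. Chamber complex: let $b=(2,1,2,1,3,2)$, $c=(1,1,1,1,2,1)$, $f=(1,0,1,0,1,1)$, $d_1=(1,1,1,0,1,1)$, $e_1=(1,1,0,0,1,1)$, $g_1=(1,0,0,0,1,0)$, $d_2=(1,0,1,1,1,1)$, $e_2=(0,0,1,1,1,1)$, $g_2=(0,0,1,0,1,0)$. The chambers are the $18$ closed cones in $\mathbb{R}^6$ generated by: $\kappa_1:b,c,d_1,e_2,d_2,e_1$; $\kappa_2:b,c,d_1,g_1,d_2,g_2$; $\kappa_3:b,c,e_2,g_1,e_1,g_2$; $\kappa_4:b,f,d_1,e_2,d_2,e_1$; $\kappa_5:b,f,d_1,g_1,d_2,g_2$; $\kappa_6:b,f,e_2,g_1,e_1,g_2$; $\kappa_7:b,c,d_1,g_1,d_2,e_1$; $\kappa_8:b,c,d_1,e_2,d_2,g_2$; $\kappa_9:b,c,d_1,e_2,e_1,g_2$; $\kappa_{10}:b,c,e_2,g_1,d_2,e_1$; $\kappa_{11}:b,c,d_1,g_1,e_1,g_2$; $\kappa_{12}:b,c,e_2,g_1,d_2,g_2$; $\kappa_{13}:b,f,d_1,g_1,d_2,e_1$; $\kappa_{14}:b,f,d_1,e_2,d_2,g_2$; $\kappa_{15}:b,f,d_1,g_1,e_1,g_2$; $\kappa_{16}:b,f,e_2,g_1,d_2,g_2$; $\kappa_{17}:b,f,d_1,e_2,e_1,g_2$;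 $\kappa_{18}:b,f,e_2,g_1,d_2,e_1$. (Known fact, due to Rassart: the union of these chambers is the support of $C$, and on the integer points of each chamber $C$ agrees with a polynomial, respectively: $1-\lambda_2-\mu_2+\nu_1$; $1+\nu_2-\nu_3$; $1+\lambda_1+\mu_1-\nu_1$; $1+\nu_1-\nu_2$; $1+\lambda_2+\mu_2-\nu_3$; $1+\nu_3$; $1+\mu_1-\nu_3$; $1+\lambda_1-\nu_3$; $1+\lambda_1-\lambda_2$; $1+\mu_1-\mu_2$; $1-\lambda_2+\nu_2$; $1-\mu_2+\nu_2$; $1-\lambda_1+\nu_1$; $1-\mu_1+\nu_1$; $1+\mu_2$; $1+\lambda_2$; $1+\lambda_1+\mu_2-\nu_2$; $1+\lambda_2+\mu_1-\nu_2$ for $\kappa_1,\dots,\kappa_{18}$.) A linear symmetry of $C$ acts on chambers via its $\mathbb{R}$-linear extension. *)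

(* Defs.v *)
From HB Require Import structures.
From mathcomp Require Import all_boot all_order all_algebra all_fingroup.
From mathcomp Require Import finmap mpoly ring.
From mathcomp Require Import boolp classical_sets functions cardinality reals.

Set Implicit Arguments.
Unset Strict Implicit.
Unset Printing Implicit Defensive.

Import Order.TTheory GRing.Theory Num.Theory.
Local Open Scope classical_set_scope.
Local Open Scope ring_scope.

(* Schur polynomials in n variables, as ratios of alternants (equivalently, the
   characters of the irreducible polynomial representations of GL_n). A
   partition with at most n parts is a weakly decreasing n-tuple, padded with
   zeros. *)

Definition is_partition n (la : n.-tuple nat) : bool := sorted geq la.

Definition alternant n (a : 'I_n -> nat) : {mpoly int[n]} :=
  \det (\matrix_(i < n, j < n) 'X_i ^+ a j).

Definition schur n (la : n.-tuple nat) : {fraction {mpoly int[n]}} :=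
  tofrac (alternant (fun j : 'I_n => tnth la j + (n - j.+1))%N) /
  tofrac (alternant (fun j : 'I_n => n - j.+1)%N).

Definition schur_expansion n (f : {fraction {mpoly int[n]}})
    (c : {fsfun n.-tuple nat -> int with 0}) : Prop :=
  (forall nu, nu \in finsupp c -> is_partition nu) /\
  f = \sum_(nu <- finsupp c) (c nu)%:~R * schur nu.

(* The coefficients of f in the Schur basis. The value is only meaningful when
   f is a symmetric polynomial, in which case its expansion exists and is
   unique. *)
Definition schur_coef n (f : {fraction {mpoly int[n]}}) :
    {fsfun n.-tuple nat -> int with 0} :=
  xget [fsfun] [set c | schur_expansion f c].

(* For partitions with at most n parts, n variables suffice to compute the
   coefficient of s_nu in s_la * s_mu. *)
Definition LRcoef n (la mu nu : n.-tuple nat) : int :=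
  schur_coef (schur la * schur mu) nu.

Definition is_partitionz n (la : n.-tuple int) : bool :=
  sorted (fun x y => y <= x) la && all (fun x => 0 <= x) la.

(* Extension by zero to all integer vectors. *)
Definition LRcoefz n (la mu nu : n.-tuple int) : int :=
  if [&& is_partitionz la, is_partitionz mu & is_partitionz nu]
  then LRcoef (map_tuple absz la) (map_tuple absz mu) (map_tuple absz nu)
  else 0.

(* Z^6 is the type of column vectors, so that the product of matrices is the
   composition of the linear maps. *)

Definition vec6 (x0 x1 x2 x3 x4 x5 : int) : 'cV[int]_6 :=
  \col_(i < 6) [:: x0; x1; x2; x3; x4; x5]`_i.

Definition on_coords A (f : int -> int -> int -> int -> int -> int -> A)
    (v : 'cV[int]_6) : A :=
  f (v 0 0) (v 1 0) (v 2 0) (v 3 0) (v 4 0) (v 5 0).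

Definition C : 'cV[int]_6 -> int :=
  on_coords (fun l1 l2 m1 m2 n1 n2 =>
    let n3 := l1 + l2 + m1 + m2 - n1 - n2 in
    LRcoefz [tuple l1; l2; 0] [tuple m1; m2; 0] [tuple n1; n2; n3]).

Definition linear_symmetry : set 'M[int]_6 :=
  [set F | F \in unitmx /\ forall v : 'cV[int]_6, C (F *m v) = C v].

Definition symS : 'cV[int]_6 -> 'cV[int]_6 :=
  on_coords (fun l1 l2 m1 m2 n1 n2 => vec6 m1 m2 l1 l2 n1 n2).

Definition symU : 'cV[int]_6 -> 'cV[int]_6 :=
  on_coords (fun l1 l2 m1 m2 n1 n2 =>
    let n3 := l1 + l2 + m1 + m2 - n1 - n2 in
    vec6 (n1 - n3) (n1 - n2) m1 m2 n1 (n1 - l2)).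

Definition symT : 'cV[int]_6 -> 'cV[int]_6 :=
  on_coords (fun l1 l2 m1 m2 n1 n2 =>
    let n3 := l1 + l2 + m1 + m2 - n1 - n2 in
    vec6 l1 (l1 - l2) m1 (m1 - m2) (l1 + m1 - n3) (l1 + m1 - n2)).

Definition symX : 'cV[int]_6 -> 'cV[int]_6 :=
  on_coords (fun l1 l2 m1 m2 n1 n2 =>
    vec6 (l1 + m1 - n2) (l2 + m1 - n2) n2 m2 n1 m1).

(* The matrix, in the canonical basis, of a linear endomap of Z^6. *)
Definition matrix_of (f : 'cV[int]_6 -> 'cV[int]_6) : 'M[int]_6 :=
  \matrix_(i, j) f (delta_mx j 0) i 0.

Lemma matrix_ofE (f : 'cV[int]_6 -> 'cV[int]_6) (v : 'cV[int]_6) :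
  linear f -> matrix_of f *m v = f v.
Proof.
move=> lf; pose g := HB.pack_for {linear 'cV[int]_6 -> 'cV[int]_6} f
  (GRing.isLinear.Build _ _ _ _ f lf).
rewrite -[f]/(g : _ -> _) {2}(matrix_sum_delta v) linear_sum.
apply/matrixP=> i k; rewrite ord1 mxE summxE; apply: eq_bigr => j _.
by rewrite big_ord1 linearZ !mxE mulrC.
Qed.

Lemma symS_linear : linear symS.
Proof.
by move=> a u v; apply/colP => -[[|[|[|[|[|[|]]]]]] //= ?]; rewrite !mxE /=; ring.
Qed.

Lemma symU_linear : linear symU.
Proof.
by move=> a u v; apply/colP => -[[|[|[|[|[|[|]]]]]] //= ?]; rewrite !mxE /=; ring.
Qed.

Lemma symT_linear : linear symT.
Proof.
by move=> a u v; apply/colP => -[[|[|[|[|[|[|]]]]]] //= ?]; rewrite !mxE /=; ring.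
Qed.

Lemma symX_linear : linear symX.
Proof.
by move=> a u v; apply/colP => -[[|[|[|[|[|[|]]]]]] //= ?]; rewrite !mxE /=; ring.
Qed.

Definition GL_subgroup n (H : set 'M[int]_n) : Prop :=
  [/\ H `<=` [set F | F \in unitmx], H 1%:M,
      forall F G, H F -> H G -> H (F *m G) &
      forall F, H F -> H (invmx F)].

Definition gen_GL n (A : set 'M[int]_n) : set 'M[int]_n :=
  smallest (@GL_subgroup n) A.

Definition known_symmetries : set 'M[int]_6 :=
  gen_GL [set matrix_of symS; matrix_of symT; matrix_of symU].

Definition isog_GL (gT : finGroupType) (G : {group gT}) n
    (H : set 'M[int]_n) : Prop :=
  exists phi : gT -> 'M[int]_n,
    [/\ {in G &, injective phi},
        {in G &, forall x y, phi (x * y)%g = phi x *m phi y} &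
        phi @` [set x | x \in G] = H].

(* The wreath product S_3 wr S_2, as the group of permutations of a 6-element
   set which permute the two blocks {b} * 'I_3: it is the setwise stabiliser of
   the set of blocks. *)
Definition blocks : {set {set 'I_2 * 'I_3}} :=
  [set [set x : 'I_2 * 'I_3 | x.1 == b] | b : 'I_2]%SET.

Definition wreath_S3_S2 : {group {perm 'I_2 * 'I_3}} := 'N(blocks | 'P^*)%G.

Definition ray_b  := vec6 2 1 2 1 3 2.
Definition ray_c  := vec6 1 1 1 1 2 1.
Definition ray_f  := vec6 1 0 1 0 1 1.
Definition ray_d1 := vec6 1 1 1 0 1 1.
Definition ray_e1 := vec6 1 1 0 0 1 1.
Definition ray_g1 := vec6 1 0 0 0 1 0.
Definition ray_d2 := vec6 1 0 1 1 1 1.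
Definition ray_e2 := vec6 0 0 1 1 1 1.
Definition ray_g2 := vec6 0 0 1 0 1 0.

Definition chamber_rays : seq (seq 'cV[int]_6) :=
  let b := ray_b in let c := ray_c in let f := ray_f in
  let d1 := ray_d1 in let e1 := ray_e1 in let g1 := ray_g1 in
  let d2 := ray_d2 in let e2 := ray_e2 in let g2 := ray_g2 in
  [:: [:: b; c; d1; e2; d2; e1]; [:: b; c; d1; g1; d2; g2];
      [:: b; c; e2; g1; e1; g2]; [:: b; f; d1; e2; d2; e1];
      [:: b; f; d1; g1; d2; g2]; [:: b; f; e2; g1; e1; g2];
      [:: b; c; d1; g1; d2; e1]; [:: b; c; d1; e2; d2; g2];
      [:: b; c; d1; e2; e1; g2]; [:: b; c; e2; g1; d2; e1];
      [:: b; c; d1; g1; e1; g2]; [:: b; c; e2; g1; d2; g2];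
      [:: b; f; d1; g1; d2; e1]; [:: b; f; d1; e2; d2; g2];
      [:: b; f; d1; g1; e1; g2]; [:: b; f; e2; g1; d2; g2];
      [:: b; f; d1; e2; e1; g2]; [:: b; f; e2; g1; d2; e1]].

Definition realmx (R : realType) m n (A : 'M[int]_(m, n)) : 'M[R]_(m, n) :=
  map_mx intr A.

Definition cone (R : realType) (s : seq 'cV[int]_6) : set 'cV[R]_6 :=
  [set x | exists t : 'I_(size s) -> R, (forall i, 0 <= t i) /\
     x = \sum_(i < size s) t i *: realmx R s`_i].

Definition chamber (R : realType) (k : 'I_18) : set 'cV[R]_6 :=
  @cone R (nth [::] chamber_rays k).

Definition chamber_image (R : realType) (F : 'M[int]_6) (K : set 'cV[R]_6) :
    set 'cV[R]_6 :=
  [set realmx R F *m x | x in K].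

(* Main.v *)
Require Import Defs.
From Stdlib Require Import ZArith Lia.
From HB Require Import structures.
From mathcomp Require Import all_boot all_order all_algebra all_fingroup all_solvable.
From mathcomp Require Import finmap mpoly zify ssrZ ring.
From mathcomp Require Import boolp classical_sets functions cardinality reals.

(* Kostka numbers of GL_3 have a closed form, and extracting the coefficient of
   x^(nu + delta) in a_(la + delta) s_mu (Klimyk's formula) gives
   C = max(0, 1 + min of 18 linear forms). In terms of the rays c, f and of the
   two blocks x = (g1, e2, d1), y = (g2, e1, d2), which satisfy
   c + f = x1 + x2 + x3 = y1 + y2 + y3 = b, this reads
     C (sum_i p_i r_i + sum_j q_j x_j + sum_k q'_k y_k)
       = max(0, 1 + min p + min q + min q'),
   so S_2 x (S_3 wr S_2) acts by symmetries. Conversely the integer points of the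
   support of C form the monoid generated by the eight rays c, f, x_j, y_k, which
   are its indecomposable elements; a linear symmetry therefore permutes them. It
   preserves {c, f}, the value of C being 2 at c + f, hence it fixes b, and so it
   preserves the partition {x, y}. *)

Set Implicit Arguments.
Unset Strict Implicit.
Unset Printing Implicit Defensive.

Import Order.TTheory GRing.Theory Num.Theory GroupScope.
Local Open Scope classical_set_scope.
Local Open Scope card_scope.
Local Open Scope ring_scope.

(** * Littlewood-Richardson coefficients of GL_3 *)

Local Open Scope Z_scope.

(** Schur coefficients are defined by choosing some expansion in a fraction field, so they are
    brought back to coefficients of antisymmetric polynomials at strictly decreasing exponents. The
    closed form of the Kostka numbers is not derived from tableaux: the polynomial with these
    coefficients is recognised as [s_mu] by the case [la = 0] of the very computation that yields
    the formula for [C]. The eight rays span a lattice of rank 6, so coefficients on them are only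
    defined up to two relations. What survives are the 18 sums over triples of labels, one in each
    group. Equality of vectors, lower bounds on [C], extremality of the rays and the shape of the
    chambers are all read off these triples, and a permutation of the labels acts linearly as soon
    as it permutes the triples. Conversely {c, f} is recognisable as the only pair of rays that
    meets every triple, since the two other groups have three elements. *)

Ltac minmax_free a :=
  lazymatch a with context[Z.min] => fail | context[Z.max] => fail | _ => idtac end.

(* [lia] without its preprocessing, useless on Z and costly here. *)
Ltac linear_Z := xlia zchecker.

(* Plain [lia] runs out of memory on the identity below: resolve the minima and
   maxima one at a time, discarding the infeasible orderings at each step. *)
Ltac split_minmax :=
  let cmp a b := (minmax_free a; minmax_free b;
                  let h := fresh in destruct (Z_lt_le_dec a b) as [h|h]) in
  match goal with
  | |- context[Z.min ?a ?b] =>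
    cmp a b; [rewrite -> (Z.min_l a b) by (apply: Z.lt_le_incl; assumption)
             |rewrite -> (Z.min_r a b) by assumption]
  | |- context[Z.max ?a ?b] =>
    cmp a b; [rewrite -> (Z.max_r a b) by (apply: Z.lt_le_incl; assumption)
             |rewrite -> (Z.max_l a b) by assumption]
  end; try (exfalso; linear_Z).

(** The left side is an alternating sum of sizes of three integer intervals. The cases [n1 < m1] and
    [n2 < m2] are those where mu is not contained in nu. In each of the three cases some bounds
    become redundant, and removing them beforehand keeps the case analysis small. *)
Lemma lr_count_intervals_Z l1 l2 m1 m2 n1 n2 n3 :
  n3 = l1 + l2 + m1 + m2 - n1 - n2 -> l1 >= l2 -> l2 >= 0 -> m1 >= m2 ->
  m2 >= 0 -> n1 >= n2 -> n2 >= n3 -> n3 >= 0 ->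
  Z.max 0 (1 + Z.min (Z.min m2 (m1 - n3)) (Z.min (n1 - l1) (n2 - l2))
    - Z.max (Z.max 0 (m2 - n3)) (n2 - l1))
  - Z.max 0 (1 + Z.min (Z.min m2 (m1 - (n3 - l2 - 1))) (Z.min (n1 - l1) (n2 + 1))
    - Z.max (Z.max 0 (m2 - (n3 - l2 - 1))) (n2 - l1))
  + Z.max 0 (1 + Z.min (Z.min m2 (m1 - (n3 - l1 - 2))) (Z.min (n1 + 1 - l2) (n2 + 1))
    - Z.max (Z.max 0 (m2 - (n3 - l1 - 2))) (n2 + 1 - l2))
  = Z.max 0 (1 + Z.min (l2 + m2 - n2) 0
      + Z.min (n1 - l2 - m2) (Z.min (n1 + n2 - l1 - l2 - m2) (m1 - m2))
      + Z.min 0 (Z.min (n2 - m1) (l1 + m2 - n1))).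
Proof.
move=> e *; set rhs := Z.max 0 (1 + Z.min _ _ + _ + _).
have [h|[h|[h h']]] : n1 < m1 \/ n2 < m2 \/ n1 >= m1 /\ n2 >= m2 by lia.
(* One of the 18 forms is [(l2 + m2 - n2) + (n1 - l2 - m2) + (n2 - m1) = n1 - m1]. *)
- have -> : rhs = 0 by rewrite /rhs; lia.
  replace (Z.max (Z.max 0 (m2 - n3)) (n2 - l1)) with (Z.max 0 (n2 - l1)) by lia.
  replace (Z.max (Z.max 0 (m2 - (n3 - l2 - 1))) (n2 - l1))
    with (Z.max 0 (n2 - l1)) by lia.
  replace (Z.max (Z.max 0 (m2 - (n3 - l1 - 2))) (n2 + 1 - l2))
    with (Z.max 0 (n2 + 1 - l2)) by lia.
  by repeat split_minmax; linear_Z.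
(* Here the negative form is [0 + (m1 - m2) + (n2 - m1) = n2 - m2]. *)
- have -> : rhs = 0 by rewrite /rhs; lia.
  replace (Z.min (Z.min m2 (m1 - n3)) (Z.min (n1 - l1) (n2 - l2)))
    with (Z.min (m1 - n3) (n2 - l2)) by lia.
  replace (Z.min (Z.min m2 (m1 - (n3 - l2 - 1))) (Z.min (n1 - l1) (n2 + 1)))
    with (Z.min (m1 - (n3 - l2 - 1)) (n2 + 1)) by lia.
  replace (Z.min (Z.min m2 (m1 - (n3 - l1 - 2))) (Z.min (n1 + 1 - l2) (n2 + 1)))
    with (Z.min (m1 - (n3 - l1 - 2)) (n2 + 1)) by lia.
  by repeat split_minmax; linear_Z.
replace (Z.max (Z.max 0 (m2 - (n3 - l2 - 1))) (n2 - l1))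
  with (Z.max 0 (m2 - (n3 - l2 - 1))) by lia.
replace (Z.max (Z.max 0 (m2 - (n3 - l1 - 2))) (n2 + 1 - l2))
  with (Z.max 0 (m2 - (n3 - l1 - 2))) by lia.
replace (Z.min (Z.min m2 (m1 - (n3 - l2 - 1))) (Z.min (n1 - l1) (n2 + 1)))
  with (Z.min m2 (n1 - l1)) by lia.
replace (Z.min (Z.min m2 (m1 - (n3 - l1 - 2))) (Z.min (n1 + 1 - l2) (n2 + 1)))
  with (Z.min m2 (n1 + 1 - l2)) by lia.
by rewrite /rhs; repeat split_minmax; linear_Z.
Qed.

Close Scope Z_scope.

Lemma Z_of_intE :
  ((forall x y, Z_of_int (Num.min x y) = Z.min (Z_of_int x) (Z_of_int y)) *
   (forall x y, Z_of_int (Num.max x y) = Z.max (Z_of_int x) (Z_of_int y)) *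
   (forall x y : int, Z_of_int (x + y) = Z.add (Z_of_int x) (Z_of_int y)) *
   (forall x : int, Z_of_int (- x) = Z.opp (Z_of_int x)) *
   (Z_of_int 0 = Z0) * (Z_of_int 1 = Zpos xH) * (Z_of_int 2 = Zpos (xO xH)))%type.
Proof. by do !split=> // *; lia. Qed.

(* 1 + the minimum of the 18 polynomials listed with the chambers, each minus 1,
   grouped as a sum of three minima; n1 + n2 - l1 - l2 - m2 is m1 - n3. *)
Definition lr_count (l1 l2 m1 m2 n1 n2 : int) : int :=
  Num.max 0 (1 + Num.min (l2 + m2 - n2) 0
    + Num.min (n1 - l2 - m2) (Num.min (n1 + n2 - l1 - l2 - m2) (m1 - m2))
    + Num.min 0 (Num.min (n2 - m1) (l1 + m2 - n1))).

Lemma lr_count_intervals (m1 m2 l1 l2 n1 n2 n3 : int) :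
  n3 = l1 + l2 + m1 + m2 - n1 - n2 -> l2 <= l1 -> 0 <= l2 -> m2 <= m1 ->
  0 <= m2 -> n2 <= n1 -> n3 <= n2 -> 0 <= n3 ->
  Num.max 0 (1 + Num.min (Num.min m2 (m1 - n3)) (Num.min (n1 - l1) (n2 - l2))
    - Num.max (Num.max 0 (m2 - n3)) (n2 - l1))
  - Num.max 0 (1 + Num.min (Num.min m2 (m1 - (n3 - l2 - 1))) (Num.min (n1 - l1) (n2 + 1))
    - Num.max (Num.max 0 (m2 - (n3 - l2 - 1))) (n2 - l1))
  + Num.max 0 (1 + Num.min (Num.min m2 (m1 - (n3 - l1 - 2))) (Num.min (n1 + 1 - l2) (n2 + 1))
    - Num.max (Num.max 0 (m2 - (n3 - l1 - 2))) (n2 + 1 - l2))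
  = lr_count l1 l2 m1 m2 n1 n2.
Proof.
move=> e *; apply: (can_inj Z_of_intK).
rewrite /lr_count !Z_of_intE.
refine (@lr_count_intervals_Z (Z_of_int l1) (Z_of_int l2) (Z_of_int m1)
  (Z_of_int m2) (Z_of_int n1) (Z_of_int n2) (Z_of_int n3) _ _ _ _ _ _ _ _); lia.
Qed.

(* The Kostka number of shape (m1, m2, 0) and weight (w1, w2, w3): the number of
   Gelfand-Tsetlin patterns, i.e. of integers q between max(0, m2 - w3) and
   min(m2, m1 - w3, w1, w2). *)
Definition weight_mult (m1 m2 w1 w2 w3 : int) : int :=
  if w1 + w2 + w3 == m1 + m2 then
    Num.max 0 (1 + Num.min (Num.min m2 (m1 - w3)) (Num.min w1 w2) - Num.max 0 (m2 - w3))
  else 0.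

(* Both weights have the same third entry, so that the two sets of q differ only
   in the constraints q <= min(a, b) and q <= min(c, d) = d. *)
Lemma weight_mult_pair (m1 m2 a b c d w : int) :
  a + b = c + d -> d < a -> d < b -> d < c ->
  weight_mult m1 m2 a b w - weight_mult m1 m2 c d w =
  if a + b + w == m1 + m2 then
    Num.max 0 (1 + Num.min (Num.min m2 (m1 - w)) (Num.min a b)
      - Num.max (Num.max 0 (m2 - w)) (d + 1))
  else 0.
Proof. move=> abcd; rewrite /weight_mult abcd; case: eqP => // _; lia. Qed.

Lemma weight_mult_sym12 m1 m2 a b c : weight_mult m1 m2 a b c = weight_mult m1 m2 b a c.
Proof. by rewrite /weight_mult (addrC a) [Num.min a b]minC. Qed.

(** The bounds single out the third entry; the symmetry only appears once the total weight is known
    to be [m1 + m2]. *)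
Lemma weight_mult_sym23 m1 m2 a b c : weight_mult m1 m2 a b c = weight_mult m1 m2 a c b.
Proof. rewrite /weight_mult addrAC; case: eqP => // e; lia. Qed.

(** [K i j k] is the multiplicity of the weight [nu + delta - (i, j, k)], and the signed sum runs
    over the permutations of [la + delta = (a, b, 0)]. *)
Lemma klimyk (l1 l2 m1 m2 n1 n2 n3 : int) :
  l2 <= l1 -> 0 <= l2 -> m2 <= m1 -> 0 <= m2 -> n2 <= n1 -> n3 <= n2 -> 0 <= n3 ->
  let K i j k := weight_mult m1 m2 (n1 + 2 - i) (n2 + 1 - j) (n3 - k) in
  let a := l1 + 2 in let b := l2 + 1 in
  K a b 0 - K b a 0 - K a 0 b + K 0 a b + K b 0 a - K 0 b a =
  if n3 == l1 + l2 + m1 + m2 - n1 - n2 then lr_count l1 l2 m1 m2 n1 n2 else 0.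
Proof.
move=> h1 h2 h3 h4 h5 h6 h7 K a b.
(* Terms with the same last entry are paired, so that each difference counts a single interval. *)
transitivity ((K a b 0 - K b a 0) - (K a 0 b - K 0 a b) + (K b 0 a - K 0 b a)); first lia.
rewrite /K !weight_mult_pair; [|rewrite /a /b; lia..].
have [e|ne] := eqVneq n3; last by rewrite !ifF ?subrr ?addr0 //; rewrite /a /b; lia.
rewrite -(lr_count_intervals e) // !ifT; [|rewrite /a /b; lia..].
congr (Num.max _ _ - Num.max _ _ + Num.max _ _);
  congr (_ + Num.min (Num.min _ _) (Num.min _ _) - Num.max (Num.max _ _) _);
  by rewrite /a /b; ring.
Qed.

(** * Antisymmetric polynomials and coefficients in the Schur basis *)

Definition antisymmetric_mpoly n (p : {mpoly int[n]}) : Prop :=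
  forall s : 'S_n, msym s p = (-1) ^+ s *: p.

Lemma alternantE n (a : 'I_n -> nat) :
  alternant a = \sum_(s : 'S_n) (-1) ^+ s *: 'X_[[multinom a (s i) | i < n]].
Proof.
apply: eq_bigr => s _; rewrite mpolyXE_id -mul_mpolyC rmorphXn rmorphN1; congr (_ * _).
by apply: eq_bigr => i _; rewrite mxE mnmE.
Qed.

Lemma alternant_antisym n (a : 'I_n -> nat) : antisymmetric_mpoly (alternant a).
Proof.
move=> s; rewrite !alternantE raddf_sum scaler_sumr (reindex_inj (mulgI s)).
apply: eq_bigr => t _ /=; rewrite msymZ msymX scalerA odd_permM signr_addb.
congr (_ *: 'X_[_]); apply/mnmP => i; by rewrite !mnmE permM permKV.
Qed.

Lemma mcoeff_antisym n (p : {mpoly int[n]}) : antisymmetric_mpoly p ->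
  forall (s : 'S_n) (m : 'X_{1..n}), p@_[multinom m (s i) | i < n] = (-1) ^+ s * p@_m.
Proof. by move=> hp s m; rewrite -mcoeff_sym hp mcoeffZ. Qed.

(** Sorting an exponent changes its coefficient by a sign. If an entry is repeated, the
    transposition of two equal entries makes the coefficient its own opposite, hence zero. *)
Lemma antisym_eq0 n (p : {mpoly int[n]}) : antisymmetric_mpoly p ->
  (forall m : 'X_{1..n}, sorted gtn m -> p@_m = 0) -> p = 0.
Proof.
move=> hp h0; apply/mpolyP => m; rewrite mcoeff0.
have /tuple_permP[s es] : perm_eq (sort geq m) m by rewrite perm_sort.
pose m' : 'X_{1..n} := [multinom m (s i) | i < n].
have em' : m' = sort geq m :> seq nat.
  by rewrite es; congr (tval _); apply: eq_mktuple => i; rewrite multinomE.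
suff: p@_m' = 0.
  by rewrite mcoeff_antisym // => /eqP; rewrite mulf_eq0 signr_eq0 => /eqP.
have [u|/tuple_uniqP nu] := boolP (uniq m').
  by apply: h0; rewrite gtn_sorted_uniq_geq u em' sort_sorted // => x y; apply: leq_total.
have [i [j [ij eij]]] : exists i j, i != j /\ m' i = m' j.
  have /injectivePn[i [j ij e]] : ~~ injectiveb (tnth m') by apply/injectiveP.
  by exists i, j.
have := mcoeff_antisym hp (tperm i j) m'; rewrite odd_tperm ij expr1 mulN1r.
have -> : [multinom m' (tperm i j k) | k < n] = m'.
  by apply/mnmP => k; rewrite mnmE; case: tpermP => [->|->|].
lia.
Qed.

(** The exponent [nu + delta]; it puts partitions in bijection with strictly decreasing
    exponents. *)
Definition shifted n (nu : n.-tuple nat) : 'X_{1..n} :=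
  [multinom (tnth nu i + (n - i.+1))%N | i < n].

Lemma shifted_sorted n (nu : n.-tuple nat) : is_partition nu -> sorted gtn (shifted nu).
Proof.
move=> /(sortedP 0%N) h; apply/(sortedP 0%N) => i; rewrite size_tuple => lt_i.
have lt_i' := ltnW lt_i.
rewrite -(mnm_nth 0 (shifted nu) (Ordinal lt_i)) -(mnm_nth 0 (shifted nu) (Ordinal lt_i')).
have := h i; rewrite size_tuple => /(_ lt_i).
by rewrite !mnmE !(tnth_nth 0%N) /=; lia.
Qed.

Lemma shifted_inj n : injective (@shifted n).
Proof.
move=> nu mu /mnmP h; apply: eq_from_tnth => i; have := h i; rewrite !mnmE.
exact: addIn.
Qed.

(** Guarantees that subtracting the staircase in [shiftedP] is not truncated. *)
Lemma sorted_gtn_nth_ge (s : seq nat) i : sorted gtn s -> (i < size s)%N ->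
  (size s - i.+1 <= nth 0 s i)%N.
Proof.
elim: s i => [//|x s IH] [|i] h lt_i; last first.
  by rewrite subSS; apply: IH => //; apply: path_sorted h.
case: s IH h {lt_i} => [|y s] IH //= /andP[xy h].
by have := IH 0%N h isT; rewrite /= in xy *; lia.
Qed.

Lemma shiftedP n (m : 'X_{1..n}) : sorted gtn m ->
  exists2 nu : n.-tuple nat, is_partition nu & m = shifted nu.
Proof.
move=> hm; have ge_m (i : 'I_n) : (n - i.+1 <= m i)%N.
  by have := sorted_gtn_nth_ge (i := i) hm; rewrite size_tuple (mnm_nth 0) ltn_ord; apply.
exists [tuple (m i - (n - i.+1))%N | i < n]; last first.
  by apply/mnmP => i; rewrite mnmE tnth_mktuple subnK.
apply/(sortedP 0%N) => i; rewrite size_tuple => lt_i.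
have lt_i' := ltnW lt_i.
rewrite -(tnth_nth _ _ (Ordinal lt_i)) -(tnth_nth _ _ (Ordinal lt_i')) !tnth_mktuple.
have /(sortedP 0%N)/(_ i) := hm; rewrite size_tuple => /(_ lt_i).
rewrite -(mnm_nth 0 m (Ordinal lt_i)) -(mnm_nth 0 m (Ordinal lt_i')).
by have := ge_m (Ordinal lt_i); rewrite /=; lia.
Qed.

(** Among the rearrangements of a strictly decreasing exponent, only the identity one is strictly
    decreasing, so at most one term of the alternant contributes. *)
Lemma mcoeff_alternant n (m k : 'X_{1..n}) : sorted gtn m -> sorted gtn k ->
  (alternant m)@_k = (m == k)%:R.
Proof.
move=> hm hk; rewrite alternantE raddf_sum /= (bigD1 1%g) //= big1 => [|s s1].
  rewrite addr0 odd_perm1 expr0 scale1r mcoeffX; congr (_ == _)%:R.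
  by apply/mnmP => i; rewrite mnmE perm1.
rewrite mcoeffZ mcoeffX; case: eqP => [e|_]; last by rewrite mulr0.
case/eqP: s1; apply/permP => i; rewrite perm1.
have u : uniq m by move: hm; rewrite gtn_sorted_uniq_geq => /andP[].
have em : m = k.
  apply/val_inj/val_inj => /=.
  apply: (sorted_eq (leT := gtn)) => //.
  - by move=> x y z /= h1 h2; apply: ltn_trans h2 h1.
  - by move=> x y /=; lia.
  rewrite -e perm_sym; apply/tuple_permP; exists s.
  by congr (tval _); apply: eq_mktuple => j; rewrite multinomE.
move/tuple_uniqP: u; apply.
by move/mnmP/(_ i): e; rewrite mnmE -em.
Qed.

Lemma alternant_shifted n (nu : n.-tuple nat) :
  alternant (fun j : 'I_n => tnth nu j + (n - j.+1))%N = alternant (shifted nu).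
Proof. by congr (\det _); apply/matrixP => i j; rewrite !mxE mnmE. Qed.

Lemma alternant_staircase n :
  alternant (fun j : 'I_n => n - j.+1)%N = alternant (shifted [tuple 0%N | i < n]).
Proof. by congr (\det _); apply/matrixP => i j; rewrite !mxE mnmE tnth_mktuple. Qed.

Lemma is_partition0 n : is_partition [tuple 0%N | i < n].
Proof.
apply/(sortedP 0%N) => i; rewrite size_tuple => lt_i.
by rewrite -(tnth_nth _ _ (Ordinal lt_i)) -(tnth_nth _ _ (Ordinal (ltnW lt_i)))
  !tnth_mktuple.
Qed.

Lemma alternant_staircase_neq0 n : alternant (fun j : 'I_n => n - j.+1)%N != 0.
Proof.
rewrite alternant_staircase; apply/eqP => /(congr1 (mcoeff (shifted [tuple 0%N | i < n]))).
have h := shifted_sorted (is_partition0 n).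
by rewrite (mcoeff_alternant h h) eqxx mcoeff0.
Qed.

(** Multiplying by the Vandermonde alternant turns an identity of fractions into one of
    polynomials. *)
Lemma schur_expansion_alternant n (p : {mpoly int[n]})
    (c : {fsfun n.-tuple nat -> int with 0}) :
  schur_expansion (tofrac p / tofrac (alternant (fun j : 'I_n => n - j.+1)%N)) c <->
  (forall nu, nu \in finsupp c -> is_partition nu) /\
  p = \sum_(nu <- finsupp c) c nu *: alternant (shifted nu).
Proof.
have nz : tofrac (alternant (fun j : 'I_n => n - j.+1)%N) != 0.
  by rewrite tofrac_eq0 alternant_staircase_neq0.
rewrite /schur_expansion (eq_bigr (fun nu => tofrac (c nu *: alternant (shifted nu))
    / tofrac (alternant (fun j : 'I_n => n - j.+1)%N))); last first.
  move=> nu _; rewrite /schur alternant_shifted mulrA; congr (_ / _).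
  by rewrite -mul_mpolyC tofracM -[c nu in RHS]intz !rmorph_int.
rewrite -mulr_suml -rmorph_sum; split=> -[hc e]; split=> //; last by rewrite -e.
by apply/eqP; rewrite -tofrac_eq; apply/eqP; apply: (divIf nz).
Qed.

Lemma mcoeff_sum_alternant n (c : {fsfun n.-tuple nat -> int with 0}) nu :
  (forall nu, nu \in finsupp c -> is_partition nu) -> is_partition nu ->
  (\sum_(mu <- finsupp c) c mu *: alternant (shifted mu))@_(shifted nu) = c nu.
Proof.
move=> hc hnu; rewrite raddf_sum /=.
rewrite (eq_big_seq (fun mu => c mu * (mu == nu)%:R)); last first.
  move=> mu /hc hmu; rewrite mcoeffZ mcoeff_alternant ?shifted_sorted //.
  by rewrite (inj_eq (@shifted_inj n)).
have [hin|hnin] := boolP (nu \in finsupp c).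
  rewrite (bigD1_seq nu) ?fset_uniq // eqxx mulr1.
  by rewrite big1 => [|mu /negPf ->]; [exact: addr0|exact: mulr0].
rewrite fsfun_dflt // big1_seq // => mu /andP[_ hmu].
by case: eqP hmu hnin => [->->//|_ _ _]; rewrite mulr0.
Qed.

(** An expansion has to be exhibited, since otherwise [schur_coef] is a default value. Whichever
    expansion is chosen, its coefficients are read off at the exponents [nu + delta]. *)
Lemma schur_coef_alternant n (p : {mpoly int[n]}) nu :
  antisymmetric_mpoly p -> is_partition nu ->
  schur_coef (tofrac p / tofrac (alternant (fun j : 'I_n => n - j.+1)%N)) nu
  = p@_(shifted nu).
Proof.
move=> hp hnu.
set f := _ / _.
have [c hc] : exists c, schur_expansion f c.
  pose unshift (m : 'X_{1..n}) := [tuple (m i - (n - i.+1))%N | i < n].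
  have unshiftK mu : unshift (shifted mu) = mu.
    by apply: eq_from_tnth => i; rewrite tnth_mktuple mnmE addnK.
  (* Truncated subtraction may put extra partitions in [S]; this is harmless, as [c] takes the value
     [p@_(shifted mu)] there too. *)
  pose S := [fset mu in [seq unshift m | m <- msupp p] | is_partition mu]%fset.
  pose c : {fsfun n.-tuple nat -> int with 0} := [fsfun mu in S => p@_(shifted mu)].
  have cE mu : is_partition mu -> c mu = p@_(shifted mu).
    move=> hmu; rewrite fsfunE; case: ifPn => //; rewrite !inE hmu andbT => hin.
    apply/esym/eqP/negPn/negP; rewrite -mcoeff_msupp => hin'.
    by case/mapP: hin; exists (shifted mu).
  have hc mu : mu \in finsupp c -> is_partition mu.
    by rewrite mem_finsupp fsfunE; case: ifP => //; rewrite !inE => /andP[].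
  exists c; apply/schur_expansion_alternant; split=> //.
  apply/eqP; rewrite -subr_eq0; apply/eqP/antisym_eq0.
    move=> s; rewrite [LHS]raddfB /= hp scalerBr; congr (_ - _).
    rewrite raddf_sum scaler_sumr.
    apply: eq_bigr => mu _; rewrite /= msymZ alternant_antisym.
    by rewrite !scalerA mulrC.
  move=> m /shiftedP[mu hmu ->].
  by rewrite mcoeffB mcoeff_sum_alternant // cE // subrr.
rewrite /schur_coef; case: xgetP => [c' _ /schur_expansion_alternant[hc' ->]|/(_ c)//].
by rewrite mcoeff_sum_alternant.
Qed.

(** * Schur polynomials in three variables *)

Lemma det_mx33 (R : comNzRingType) (A : 'M[R]_3) :
  \det A = A 0 0 * A 1 1 * A 2 2 - A 0 1 * A 1 0 * A 2 2 - A 0 0 * A 1 2 * A 2 1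
    + A 0 1 * A 1 2 * A 2 0 + A 0 2 * A 1 0 * A 2 1 - A 0 2 * A 1 1 * A 2 0.
Proof.
have [B eq] : exists B : nat -> nat -> R, forall i j : 'I_3, A i j = B i j.
  by exists (fun i j => A (inord i) (inord j)) => i j; rewrite !inord_val.
rewrite (expand_det_row _ 0) !big_ord_recl big_ord0 /cofactor.
rewrite !(expand_det_row _ ord0) !big_ord_recl !big_ord0 /cofactor !det_mx11 !mxE /=.
by rewrite !eq /= /bump /= !(expr0, expr1, exprS); ring.
Qed.

Lemma forall_ord3 (P : 'I_3 -> Prop) : P 0 -> P 1 -> P 2 -> forall i, P i.
Proof.
move=> h0 h1 h2 [[|[|[|//]]] h].
- by rewrite (_ : Ordinal h = 0) //; apply: val_inj.
- by rewrite (_ : Ordinal h = 1) //; apply: val_inj.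
- by rewrite (_ : Ordinal h = 2) //; apply: val_inj.
Qed.

Lemma sym3_perm T U (f : T -> T -> T -> U) (g : 'I_3 -> T) (s : 'S_3) :
  (forall a b c, f a b c = f b a c) -> (forall a b c, f a b c = f a c b) ->
  f (g (s 0)) (g (s 1)) (g (s 2)) = f (g 0) (g 1) (g 2).
Proof.
move=> f12 f23; have f13 a b c : f a b c = f c b a by rewrite f12 f23 f12.
have s01 : s 0 != s 1 by rewrite (inj_eq perm_inj).
have s02 : s 0 != s 2 by rewrite (inj_eq perm_inj).
have s12 : s 1 != s 2 by rewrite (inj_eq perm_inj).
move: (s 0) (s 1) (s 2) s01 s02 s12.
apply: forall_ord3; apply: forall_ord3; apply: forall_ord3 => //= _ _ _;
  by [| rewrite f12 | rewrite f23 | rewrite f13 | rewrite f12 f23 | rewrite f23 f12].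
Qed.

Lemma mcoeffXM n (p : {mpoly int[n]}) (k m : 'X_{1..n}) :
  ('X_[k] * p)@_m = if (k <= m)%MM then p@_(m - k) else 0.
Proof.
rewrite mulrC; case: ifPn => [le_km|]; first by rewrite -[m in LHS](submK le_km) addmC mcoeffMX.
apply: contraNeq; rewrite -mcoeff_msupp (perm_mem (msuppMX _ _)) => /mapP[m' _ ->].
exact: lem_addr.
Qed.

(** The Schur polynomial of [(m1, m2, 0)], written as the sum of its weights;
    [alternant_weight_poly] justifies the name. *)
Definition weight_poly (m1 m2 : nat) : {mpoly int[3]} :=
  \sum_(m : 'X_{1..3 < (m1 + m2).+1}) weight_mult m1 m2 (m 0) (m 1) (m 2) *: 'X_[m].

Lemma mdeg3 (m : 'X_{1..3}) : mdeg m = (m 0%R + m 1%R + m 2%R)%N.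
Proof.
rewrite mdegE !big_ord_recl big_ord0 addn0 addnA; congr (m _ + m _ + m _)%N; exact: val_inj.
Qed.

Lemma mcoeff_weight_poly m1 m2 (m : 'X_{1..3}) :
  (weight_poly m1 m2)@_m = weight_mult m1 m2 (m 0) (m 1) (m 2).
Proof.
have [lt_m|ge_m] := ltnP (mdeg m) (m1 + m2).+1.
  by rewrite /weight_poly (mcoeff_mpoly (fun m : 'X_{1..3} => weight_mult m1 m2 (m 0) (m 1) (m 2))).
rewrite raddf_sum big1 => [|m' _]; last first.
  rewrite /= mcoeffZ mcoeffX; case: eqP => [e|_]; last exact: mulr0.
  by have := bmdeg m'; rewrite e ltnNge ge_m.
by rewrite mdeg3 in ge_m; rewrite /weight_mult ifF //; lia.
Qed.

(** Allows exponents to be subtracted in [int] when multiplying by a monomial, without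
    distinguishing whether the monomial divides. *)
Lemma weight_mult_neg m1 m2 a b c : 0 <= m2 -> (a < 0) || (b < 0) || (c < 0) ->
  weight_mult m1 m2 a b c = 0.
Proof. by rewrite /weight_mult => ? ?; case: eqP => //; lia. Qed.

Lemma mcoeffX_weight_poly m1 m2 (k m : 'X_{1..3}) :
  ('X_[k] * weight_poly m1 m2)@_m =
  weight_mult m1 m2 ((m 0)%:Z - (k 0)%:Z) ((m 1)%:Z - (k 1)%:Z) ((m 2)%:Z - (k 2)%:Z).
Proof.
rewrite mcoeffXM mcoeff_weight_poly; case: mnm_lepP => [h|h].
  by rewrite !mnmE !subzn.
rewrite weight_mult_neg //; apply/negPn/negP => h'; case: h.
by apply: forall_ord3; lia.
Qed.

Lemma weight_poly_sym m1 m2 s : msym s (weight_poly m1 m2) = weight_poly m1 m2.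
Proof.
apply/mpolyP => m; rewrite mcoeff_sym !mcoeff_weight_poly !mnmE.
apply: (sym3_perm (f := fun a b c : nat => weight_mult m1 m2 a b c)) => a b c.
  exact: weight_mult_sym12.
exact: weight_mult_sym23.
Qed.

Definition mnm3 a b c : 'X_{1..3} := [multinom [tuple a; b; c]].

Lemma mnm3E a b c : (mnm3 a b c 0 = a) * (mnm3 a b c 1 = b) * (mnm3 a b c 2 = c).
Proof. by rewrite /mnm3 !multinomE !(tnth_nth 0%N). Qed.

Lemma mpolyX3 a b c : 'X_0 ^+ a * 'X_1 ^+ b * 'X_2 ^+ c = 'X_[mnm3 a b c] :> {mpoly int[3]}.
Proof.
rewrite [RHS]mpolyXE_id !big_ord_recl big_ord0 mulr1 mulrA.
rewrite (_ : lift ord0 (lift ord0 ord0) = 2 :> 'I_3); last exact: val_inj.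
rewrite (_ : lift ord0 ord0 = 1 :> 'I_3); last exact: val_inj.
done.
Qed.

Lemma alternant3 (a : 'I_3 -> nat) : alternant a =
  'X_[mnm3 (a 0) (a 1) (a 2)] - 'X_[mnm3 (a 1) (a 0) (a 2)] - 'X_[mnm3 (a 0) (a 2) (a 1)]
  + 'X_[mnm3 (a 2) (a 0) (a 1)] + 'X_[mnm3 (a 1) (a 2) (a 0)] - 'X_[mnm3 (a 2) (a 1) (a 0)].
Proof. by rewrite /alternant det_mx33 !mxE !mpolyX3 [X in X - _]addrAC. Qed.

Lemma mcoeff_alternant_weight_poly (l1 l2 m1 m2 n1 n2 n3 : nat) :
  (l2 <= l1)%N -> (m2 <= m1)%N -> (n2 <= n1)%N -> (n3 <= n2)%N ->
  (alternant (shifted [tuple l1; l2; 0%N]) * weight_poly m1 m2)@_(shifted [tuple n1; n2; n3]) =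
  if n3%:Z == l1%:Z + l2%:Z + m1%:Z + m2%:Z - n1%:Z - n2%:Z
  then lr_count l1 l2 m1 m2 n1 n2 else 0.
Proof.
move=> h1 h2 h3 h4; rewrite -klimyk; [|lia..].
rewrite alternant3 !(mulrBl, mulrDl, mulNr) !(mcoeffD, mcoeffN) !mcoeffX_weight_poly !mnm3E !mnmE.
rewrite !(tnth_nth 0%N) /=.
congr (_ - _ - _ + _ + _ - _); congr weight_mult; lia.
Qed.

(** The case [la = 0] of the preceding formula: [lr_count 0 0 m1 m2 n1 n2], with the condition on
    [n3], is the indicator of nu = mu, so the two antisymmetric sides agree at all strictly
    decreasing exponents. *)
Lemma alternant_weight_poly (m1 m2 : nat) : (m2 <= m1)%N ->
  alternant (shifted [tuple 0%N | i < 3]) * weight_poly m1 m2 =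
  alternant (shifted [tuple m1; m2; 0%N]).
Proof.
move=> h; rewrite (_ : [tuple 0%N | i < 3] = [tuple 0%N; 0%N; 0%N]); last first.
  by apply/val_inj => /=; rewrite /= enum_ordSl /= enum_ordSl /= enum_ordSl enum_ord0.
have hm : is_partition [tuple m1; m2; 0%N] by rewrite /is_partition /= h.
apply/eqP; rewrite -subr_eq0; apply/eqP/antisym_eq0.
  move=> s; rewrite [LHS]raddfB /= msymM weight_poly_sym !alternant_antisym.
  by rewrite scalerBr scalerAl.
move=> m /shiftedP[nu]; case: nu => -[|n1 [|n2 [|n3 []]]] // i hn ->.
rewrite (_ : Tuple i = [tuple n1; n2; n3]) in hn *; last exact: val_inj.
have /and3P[h21 h32 _] : [&& n2 <= n1, n3 <= n2 & true]%N by [].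
rewrite mcoeffB mcoeff_alternant_weight_poly // mcoeff_alternant ?shifted_sorted //.
rewrite (inj_eq (@shifted_inj 3)) -val_eqE /= !eqseq_cons /lr_count.
rewrite [_ == [::]]eqxx andbT; case: eqP => e.
  by case: (boolP [&& _, _ & _]) => hb; rewrite ?mulr1n ?mulr0n; lia.
by case: (boolP [&& _, _ & _]) => hb; rewrite ?mulr1n ?mulr0n //; lia.
Qed.

Lemma LRcoef3 (l1 l2 m1 m2 n1 n2 n3 : nat) :
  (l2 <= l1)%N -> (m2 <= m1)%N -> (n2 <= n1)%N -> (n3 <= n2)%N ->
  LRcoef [tuple l1; l2; 0%N] [tuple m1; m2; 0%N] [tuple n1; n2; n3] =
  if n3%:Z == l1%:Z + l2%:Z + m1%:Z + m2%:Z - n1%:Z - n2%:Z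
  then lr_count l1 l2 m1 m2 n1 n2 else 0.
Proof.
move=> hl hm hn hn'.
have nz : tofrac (alternant (fun j : 'I_3 => 3 - j.+1)%N) != 0.
  by rewrite tofrac_eq0 alternant_staircase_neq0.
rewrite -mcoeff_alternant_weight_poly // -schur_coef_alternant; last first.
- by rewrite /is_partition /= hn hn'.
- by move=> s; rewrite msymM alternant_antisym weight_poly_sym scalerAl.
rewrite /LRcoef /schur !alternant_shifted -(alternant_weight_poly hm) -alternant_staircase.
congr (schur_coef _ _); rewrite !tofracM [X in _ * X = _]mulrAC mulfV // mul1r.
exact: mulrAC.
Qed.

(** Nonnegativity of the 18 forms already forces the three partition conditions, so the formula
    agrees with the extension of [C] by zero. *)
Lemma lr_count_gt0 l1 l2 m1 m2 n1 n2 : lr_count l1 l2 m1 m2 n1 n2 != 0 ->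
  [&& (l2 <= l1) && (0 <= l2), (m2 <= m1) && (0 <= m2) &
    [&& n2 <= n1, l1 + l2 + m1 + m2 - n1 - n2 <= n2 & 0 <= l1 + l2 + m1 + m2 - n1 - n2]].
Proof.
rewrite /lr_count => h.
have {}h : 0 <= Num.min (l2 + m2 - n2) 0
    + Num.min (n1 - l2 - m2) (Num.min (n1 + n2 - l1 - l2 - m2) (m1 - m2))
    + Num.min 0 (Num.min (n2 - m1) (l1 + m2 - n1)) by lia.
apply/and3P; split; [apply/andP|apply/andP|apply/and3P]; split; lia.
Qed.

Lemma absz_tuple3 (a b c : int) :
  map_tuple absz [tuple a; b; c] = [tuple `|a|%N; `|b|%N; `|c|%N].
Proof. exact: val_inj. Qed.

Lemma C_lr_count (v : 'cV[int]_6) : C v = on_coords lr_count v.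
Proof.
rewrite /C /on_coords.
move: (v 0 0) (v 1 0) (v 2 0) (v 3 0) (v 4 0) (v 5 0) => l1 l2 m1 m2 n1 n2.
set n3 := _ - n1 - n2.
rewrite /LRcoefz; case: ifPn => [|h]; last first.
  apply/esym/eqP/negPn; apply: contra h => /lr_count_gt0.
  rewrite -/n3 => /and3P[/andP[? ?] /andP[? ?] /and3P[? ? ?]].
  by rewrite /is_partitionz /= !andbT; apply/and3P; split; lia.
rewrite /is_partitionz /= !andbT.
move=> /and3P[/andP[/andP[l12 _] /andP[l10 l20]] /andP[/andP[m12 _] /andP[m10 m20]]].
move=> /andP[/andP[n12 n23] /and3P[n10 n20 n30]].
rewrite !absz_tuple3 LRcoef3; [|lia..].
by rewrite !gez0_abs // eqxx.
Qed.

(** * The rays and the linear forms *)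

Notation lab := ('I_2 + 'I_2 * 'I_3)%type.

(* The rays other than b, in three groups {c, f}, {g1, e2, d1}, {g2, e1, d2}, each
   with sum b. *)
Definition ray (l : lab) : 'cV[int]_6 :=
  match l with
  | inl i => [:: ray_c; ray_f]`_i
  | inr (b, a) =>
    (nth [::] [:: [:: ray_g1; ray_e2; ray_d1]; [:: ray_g2; ray_e1; ray_d2]] b)`_a
  end.

Definition raycomb (a : lab -> int) : 'cV[int]_6 := \sum_l a l *: ray l.

Definition b0 : 'I_2 := Ordinal (isT : 0 < 2)%N.
Definition b1 : 'I_2 := Ordinal (isT : 1 < 2)%N.
Definition t0 : 'I_3 := Ordinal (isT : 0 < 3)%N.
Definition t1 : 'I_3 := Ordinal (isT : 1 < 3)%N.
Definition t2 : 'I_3 := Ordinal (isT : 2 < 3)%N.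

Lemma forall_I2 (P : 'I_2 -> Prop) : P b0 -> P b1 -> forall i, P i.
Proof.
move=> h0 h1 [[|[|//]] h].
- by rewrite (_ : Ordinal h = b0) //; apply: val_inj.
- by rewrite (_ : Ordinal h = b1) //; apply: val_inj.
Qed.

Lemma forall_I3 (P : 'I_3 -> Prop) : P t0 -> P t1 -> P t2 -> forall i, P i.
Proof.
move=> h0 h1 h2 [[|[|[|//]]] h].
- by rewrite (_ : Ordinal h = t0) //; apply: val_inj.
- by rewrite (_ : Ordinal h = t1) //; apply: val_inj.
- by rewrite (_ : Ordinal h = t2) //; apply: val_inj.
Qed.

Lemma forall_lab (P : lab -> Prop) : P (inl b0) -> P (inl b1) ->
  P (inr (b0, t0)) -> P (inr (b0, t1)) -> P (inr (b0, t2)) ->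
  P (inr (b1, t0)) -> P (inr (b1, t1)) -> P (inr (b1, t2)) -> forall l, P l.
Proof.
move=> ? ? ? ? ? ? ? ? [i|[b a]]; first by elim/forall_I2: i.
by elim/forall_I2: b; elim/forall_I3: a.
Qed.

Lemma sum_lab (V : nmodType) (F : lab -> V) : \sum_l F l =
  F (inl b0) + F (inl b1) + (F (inr (b0, t0)) + F (inr (b0, t1)) + F (inr (b0, t2)))
  + (F (inr (b1, t0)) + F (inr (b1, t1)) + F (inr (b1, t2))).
Proof.
rewrite big_sumType /= (eq_bigr (fun p => F (inr (p.1, p.2)))) => [|[]//].
rewrite -(pair_bigA _ (fun b a => F (inr (b, a)))) /=.
rewrite !big_ord_recl !big_ord0 !addr0 -!addrA.
rewrite (_ : lift ord0 (lift ord0 ord0) = t2 :> 'I_3); last exact: val_inj.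
rewrite (_ : lift ord0 ord0 = t1 :> 'I_3); last exact: val_inj.
rewrite (_ : lift ord0 ord0 = b1 :> 'I_2); last exact: val_inj.
rewrite (_ : ord0 = b0); last exact: val_inj.
by rewrite (_ : ord0 = t0); last exact: val_inj.
Qed.

Lemma forall_ord6 (P : 'I_6 -> Prop) :
  P 0 -> P 1 -> P 2 -> P 3 -> P 4 -> P 5 -> forall i, P i.
Proof.
move=> h0 h1 h2 h3 h4 h5 [[|[|[|[|[|[|//]]]]]] h].
- by rewrite (_ : Ordinal h = 0) //; apply: val_inj.
- by rewrite (_ : Ordinal h = 1) //; apply: val_inj.
- by rewrite (_ : Ordinal h = 2) //; apply: val_inj.
- by rewrite (_ : Ordinal h = 3) //; apply: val_inj.
- by rewrite (_ : Ordinal h = 4) //; apply: val_inj.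
- by rewrite (_ : Ordinal h = 5) //; apply: val_inj.
Qed.

Lemma vec6P (u v : 'cV[int]_6) : u 0 0 = v 0 0 -> u 1 0 = v 1 0 -> u 2 0 = v 2 0 ->
  u 3 0 = v 3 0 -> u 4 0 = v 4 0 -> u 5 0 = v 5 0 -> u = v.
Proof. by move=> *; apply/colP; apply: forall_ord6. Qed.

Lemma raycombE (a : lab -> int) :
  let c := a (inl b0) in let f := a (inl b1) in
  let g1 := a (inr (b0, t0)) in let e2 := a (inr (b0, t1)) in let d1 := a (inr (b0, t2)) in
  let g2 := a (inr (b1, t0)) in let e1 := a (inr (b1, t1)) in let d2 := a (inr (b1, t2)) in
  raycomb a = vec6 (c + f + g1 + d1 + e1 + d2) (c + d1 + e1) (c + f + d1 + e2 + g2 + d2)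
    (c + e2 + d2) (c + c + f + g1 + e2 + d1 + g2 + e1 + d2) (c + f + e2 + d1 + e1 + d2).
Proof.
by rewrite /raycomb sum_lab; apply: vec6P; rewrite !mxE /=; ring.
Qed.

(* A triple of labels, one in each group, gives a well-defined linear form, because
   the relations between the rays only say that the three groups have equal sums. *)
Lemma raycomb_eqP (a a' : lab -> int) : raycomb a = raycomb a' <->
  forall (i : 'I_2) (j j' : 'I_2 * 'I_3), j.1 != j'.1 ->
  a (inl i) + a (inr j) + a (inr j') = a' (inl i) + a' (inr j) + a' (inr j').
Proof.
split=> [|h].
  rewrite !raycombE => /colP e i [b x] [b' x'].
  have := (e 0, e 1, e 2, e 3, e 4, e 5); rewrite !mxE /=.
  case=> [[[[[]]]]].
  elim/forall_I2: i; elim/forall_I2: b; elim/forall_I2: b' => //=;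
  elim/forall_I3: x; elim/forall_I3: x' => *; lia.
have {}h (i : 'I_2) (x y : 'I_3) : a (inl i) + a (inr (b0, x)) + a (inr (b1, y)) =
  a' (inl i) + a' (inr (b0, x)) + a' (inr (b1, y)) by apply: h.
(* Six of the 18 forms determine the six coordinates. *)
have := (h b0 t0 t0, h b0 t1 t0, h b0 t2 t0, h b1 t0 t0, h b0 t0 t1, h b0 t0 t2) => -[[[[[]]]]] *.
by rewrite !raycombE; apply: vec6P; rewrite !mxE /=; lia.
Qed.

Lemma C_raycomb (a : lab -> int) : C (raycomb a) = Num.max 0 (1 +
  Num.min (a (inl b0)) (a (inl b1)) +
  Num.min (a (inr (b0, t0))) (Num.min (a (inr (b0, t1))) (a (inr (b0, t2)))) +
  Num.min (a (inr (b1, t0))) (Num.min (a (inr (b1, t1))) (a (inr (b1, t2))))).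
Proof. rewrite C_lr_count raycombE /on_coords !mxE /= /lr_count. lia. Qed.

(** The three minima become a family of inequalities indexed by triples, which the wreath product
    permutes; positivity of [k] disposes of the maximum with 0. *)
Lemma C_raycomb_ge (a : lab -> int) (k : int) : 0 < k -> (k <= C (raycomb a) <->
  forall (i : 'I_2) (j j' : 'I_2 * 'I_3), j.1 != j'.1 ->
  k <= 1 + a (inl i) + a (inr j) + a (inr j')).
Proof.
move=> k_gt0; rewrite C_raycomb; split=> [h i [b x] [b' x']|h].
  have hi : Num.min (a (inl b0)) (a (inl b1)) <= a (inl i).
    by elim/forall_I2: i; lia.
  have h0 y : Num.min (a (inr (b0, t0)))
      (Num.min (a (inr (b0, t1))) (a (inr (b0, t2)))) <= a (inr (b0, y)).
    by elim/forall_I3: y; lia.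
  have h1 y : Num.min (a (inr (b1, t0)))
      (Num.min (a (inr (b1, t1))) (a (inr (b1, t2)))) <= a (inr (b1, y)).
    by elim/forall_I3: y; lia.
  have := (h0 x, h1 x, h0 x', h1 x').
  by elim/forall_I2: b; elim/forall_I2: b' => //= -[[[]]] *; lia.
have [i hi] : exists i, a (inl i) = Num.min (a (inl b0)) (a (inl b1)).
  by case: leP => _; [exists b0|exists b1].
have [x hx] : exists x, a (inr (b0, x)) =
    Num.min (a (inr (b0, t0))) (Num.min (a (inr (b0, t1))) (a (inr (b0, t2)))).
  by case: leP => _; [exists t0|case: leP => _; [exists t1|exists t2]].
have [y hy] : exists y, a (inr (b1, y)) =
    Num.min (a (inr (b1, t0))) (Num.min (a (inr (b1, t1))) (a (inr (b1, t2)))).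
  by case: leP => _; [exists t0|case: leP => _; [exists t1|exists t2]].
by have := h i (b0, x) (b1, y) isT; rewrite hi hx hy; lia.
Qed.

(** The coefficients normalised to vanish on f and g2. They are the arguments of the three minima in
    [lr_count]. *)
Definition raycoord (v : 'cV[int]_6) (l : lab) : int :=
  on_coords (fun l1 l2 m1 m2 n1 n2 =>
    match l with
    | inl i => [:: l2 + m2 - n2; 0]`_i
    | inr (b, a) => (nth [::] [::
        [:: n1 - l2 - m2; n1 + n2 - l1 - l2 - m2; m1 - m2];
        [:: 0; n2 - m1; l1 + m2 - n1]] b)`_a
    end) v.

Lemma raycoordK v : raycomb (raycoord v) = v.
Proof. by rewrite raycombE; apply: vec6P; rewrite !mxE /raycoord /on_coords /=; ring. Qed.

Lemma C_gt0 v : 0 < C v -> exists2 a : lab -> int, (forall l, 0 <= a l) & v = raycomb a.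
Proof.
rewrite -{1}(raycoordK v) C_raycomb; move: (raycoord v) (raycoordK v) => a <- h.
pose mp := Num.min (a (inl b0)) (a (inl b1)).
pose m0 := Num.min (a (inr (b0, t0))) (Num.min (a (inr (b0, t1))) (a (inr (b0, t2)))).
(* The shifts of the three groups add up to 0, so the vector is unchanged. The second block stays
   nonnegative because [C] is positive. *)
exists (fun l => a l + match l with inl _ => - mp
   | inr j => if j.1 == b0 then - m0 else mp + m0 end).
  by elim/forall_lab; rewrite /= /mp /m0; lia.
apply/raycomb_eqP => i [b x] [b' x'].
by elim/forall_I2: b; elim/forall_I2: b' => //= _; lia.
Qed.

Lemma eq_raycomb (a a' : lab -> int) : a =1 a' -> raycomb a = raycomb a'.
Proof. by move=> e; apply: eq_bigr => l _; rewrite e. Qed.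

Lemma ray_raycomb l : ray l = raycomb (fun k => (k == l)%:R).
Proof.
rewrite /raycomb (bigD1 l) //= eqxx scale1r big1 ?addr0 // => k /negPf->.
exact: scale0r.
Qed.

Lemma mulmx_raycomb (F : 'M[int]_6) (a : lab -> int) :
  F *m raycomb a = \sum_l a l *: (F *m ray l).
Proof. by rewrite mulmx_sumr; apply: eq_bigr => l _; rewrite -scalemxAr. Qed.

Lemma eq_mx_ray (F F' : 'M[int]_6) : (forall l, F *m ray l = F' *m ray l) -> F = F'.
Proof.
move=> h; apply/row_matrixP => i; apply/rowP => j; rewrite !mxE.
have /colP/(_ i) : F *m delta_mx j 0 = F' *m delta_mx j 0 :> 'cV_6.
  by rewrite -(raycoordK (delta_mx j 0)) !mulmx_raycomb; apply: eq_bigr => l _; rewrite h.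
by rewrite -!colE !mxE.
Qed.

Lemma raycomb_act_perm (F : 'M[int]_6) (p : {perm lab}) a :
  (forall l, F *m ray l = ray (p l)) -> F *m raycomb a = raycomb (a \o p^-1%g).
Proof.
move=> h; rewrite mulmx_raycomb /raycomb [RHS](reindex_inj (@perm_inj _ p)).
by apply: eq_bigr => l _; rewrite h /= permK.
Qed.

(** * Extremality of the rays *)

Lemma exists_ord3_neq (x y : 'I_3) : exists z, z != x /\ z != y.
Proof.
by elim/forall_I3: x; elim/forall_I3: y; solve
  [by exists t0; split | by exists t1; split | by exists t2; split].
Qed.

Lemma exists_ord2_neq (x : 'I_2) : exists z, z != x.
Proof. by elim/forall_I2: x; [exists b1|exists b0]. Qed.

(** A triple through [k] that misses [l] gives a form vanishing on [ray l]; in a nonnegative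
    combination equal to [ray l] it forces the coefficient of [k] to be 0. *)
Lemma form_avoiding (k l : lab) : k != l -> exists i (j j' : 'I_2 * 'I_3),
  [/\ j.1 != j'.1, [|| inl i == k, inr j == k | inr j' == k],
  inl i != l & inr j != l /\ inr j' != l].
Proof.
have av (b : 'I_2) : exists2 j : 'I_2 * 'I_3, j.1 = b & inr j != l.
  case: l => [i|[b' x]]; first by exists (b, t0).
  have [z [zx _]] := exists_ord3_neq x x; exists (b, z) => //.
  by apply: contraNneq zx => -[_ ->].
case: k => [i|j] kl.
  have [j j0 jl] := av b0; have [j' j'1 j'l] := av b1.
  by exists i, j, j'; split; rewrite ?j0 ?j'1 ?eqxx.
have [i il] : exists i, inl i != l.
  case: (l) => [i|?]; last by exists b0.
  by have [i' ne] := exists_ord2_neq i; exists i'; apply: contraNneq ne => -[->].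
have [b bj] := exists_ord2_neq j.1; have [j' j'b j'l] := av b.
by exists i, j, j'; split; rewrite ?j'b ?eqxx ?orbT // eq_sym.
Qed.

Lemma ray_gt0 l : 0 < ray l 4 0.
Proof. by elim/forall_lab: l; rewrite mxE. Qed.

Lemma add3_eq0 (x y z : int) : 0 <= x -> 0 <= y -> 0 <= z -> x + y + z = 0 ->
  [/\ x = 0, y = 0 & z = 0].
Proof. by split; lia. Qed.

Lemma ray_extremal (a : lab -> int) l : (forall k, 0 <= a k) -> raycomb a = ray l ->
  a =1 (fun k => (k == l)%:R).
Proof.
move=> a0 e; have /raycomb_eqP h : raycomb a = raycomb (fun k => (k == l)%:R).
  by rewrite e ray_raycomb.
have az k : k != l -> a k = 0.
  move=> /form_avoiding[i [j [j' [jj' hk il [jl j'l]]]]].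
  have := h i j j' jj'; rewrite !(negPf il, negPf jl, negPf j'l) mulr0n !addr0.
  by case/add3_eq0 => //; case/or3P: hk => /eqP<-.
move=> k; have [->{k}|kl] := eqVneq k l; last exact: az.
(* It remains to see that [a l] is 1: the coordinate n1 is positive on every ray. *)
have : raycomb a = a l *: ray l.
  rewrite /raycomb (bigD1 l) //= big1 ?addr0 // => m /az->; exact: scale0r.
rewrite e => /colP/(_ 4); rewrite mxE.
have := ray_gt0 l; move: (ray l 4 0) => x; nia.
Qed.

Lemma ray_inj : injective ray.
Proof.
move=> k l e; have h : raycomb (fun m => (m == k)%:R) = ray l by rewrite -ray_raycomb.
have := ray_extremal _ h k; rewrite eqxx; case: eqP => // _ h'.
by have /h' : forall k0 : lab, 0 <= (k0 == k)%:R :> int by move=> ?; exact: ler0n.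
Qed.

Lemma C_ray l : C (ray l) = 1.
Proof.
by rewrite ray_raycomb C_raycomb; elim/forall_lab: l.
Qed.

Lemma sum_int_eq0 (I : finType) (F : I -> int) :
  (forall i, 0 <= F i) -> \sum_i F i = 0 -> forall i, F i = 0.
Proof.
by move=> h /eqP; rewrite psumr_eq0 // => /allP e i; apply/eqP/e/mem_index_enum.
Qed.

Lemma linear_symmetry_inv F : linear_symmetry F -> linear_symmetry (invmx F).
Proof.
move=> [uF CF]; split=> [|v]; first by rewrite unitmx_inv.
by rewrite -(CF (invmx F *m v)) (mulKVmx uF).
Qed.

Lemma linear_symmetry_raycomb F : linear_symmetry F ->
  forall l, exists2 a : lab -> int, (forall k, 0 <= a k) & F *m ray l = raycomb a.
Proof. by move=> [_ CF] l; apply: C_gt0; rewrite CF C_ray. Qed.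

(* If F (ray l) = sum_k a_k ray_k and F^-1 (ray k) = sum_m b_km ray_m, then
   sum_k a_k b_km is 1 for m = l and 0 otherwise, because ray l is extremal. *)
Lemma linear_symmetry_ray F : linear_symmetry F -> forall l, exists k, F *m ray l = ray k.
Proof.
move=> hF l; have [uF _] := hF.
have [a a0 Fl] := linear_symmetry_raycomb hF l.
have /choice[b hb] : forall k, exists b : lab -> int,
    (forall m, 0 <= b m) /\ invmx F *m ray k = raycomb b.
  move=> k; have [b b0 e] := linear_symmetry_raycomb (linear_symmetry_inv hF) k.
  by exists b.
have e : raycomb (fun m => \sum_k a k * b k m) = ray l.
  rewrite -[ray l](mulKmx uF) Fl mulmx_raycomb.
  under [RHS]eq_bigr => k _ do rewrite (hb k).2 /raycomb scaler_sumr.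
  rewrite exchange_big; apply: eq_bigr => m _ /=; rewrite scaler_suml.
  by apply: eq_bigr => k _; rewrite scalerA.
have ab0 k m : 0 <= a k * b k m by rewrite mulr_ge0 // (hb k).1.
have h := ray_extremal (fun m => sumr_ge0 _ (fun k _ => ab0 k m)) e.
have [k hk] : exists k, a k * b k l != 0.
  apply/existsP; apply: contraTT isT => /existsPn hn.
  have := h l; rewrite eqxx big1 // => k _; apply/eqP; exact: negbNE (hn k).
exists k; have le1 : a k * b k l <= 1.
  by have := h l; rewrite eqxx mulr1n (bigD1 k) //= => <-; rewrite lerDl sumr_ge0.
have [ak bk] : a k = 1 /\ b k l = 1.
  have := a0 k; have := (hb k).1 l; move: hk le1; rewrite mulf_eq0 negb_or => /andP[].
  by move: (a k) (b k l) => x y *; split; nia.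
have bE : b k =1 (fun m => (m == l)%:R).
  move=> m; have [->|ml] := eqVneq m l; first by rewrite bk.
  have := h m; rewrite (negPf ml) => /sum_int_eq0-/(_ (fun k => ab0 k m) k).
  by rewrite ak mul1r.
by rewrite -(mulKVmx uF (ray k)) (hb k).2 (eq_raycomb bE) -ray_raycomb.
Qed.

(** * The symmetry group *)

Notation lab_perm := ('S_2 * {perm 'I_2 * 'I_3})%type.

Definition lab_act (g : lab_perm) (l : lab) : lab :=
  match l with inl i => inl (g.1 i) | inr j => inr (g.2 j) end.

Definition wreath_group : {group lab_perm} := setX_group [set: 'S_2]%G wreath_S3_S2.

Lemma lab_actM (g h : lab_perm) l : lab_act (g * h)%g l = lab_act h (lab_act g l).
Proof. by case: l => ?; rewrite /= permM. Qed.

Lemma lab_act1 l : lab_act 1%g l = l.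
Proof. by case: l => ?; rewrite /= perm1. Qed.

Lemma lab_actK g : cancel (lab_act g) (lab_act g^-1%g).
Proof. by move=> l; rewrite -lab_actM mulgV lab_act1. Qed.

Lemma lab_actVK g : cancel (lab_act g^-1%g) (lab_act g).
Proof. by move=> l; rewrite -lab_actM mulVg lab_act1. Qed.

Lemma lab_act_inj (g h : lab_perm) : lab_act g =1 lab_act h -> g = h.
Proof.
case: g h => [g1 g2] [h1 h2] e; congr pair; apply/permP => i.
  by have [] := e (inl i).
by have [] := e (inr i).
Qed.

(** Replaces the action on sets of sets by a pointwise condition, the form in which it bears on
    triples. *)
Lemma wreathP (s : {perm 'I_2 * 'I_3}) : reflect
  (forall j j', ((s j).1 == (s j').1) = (j.1 == j'.1)) (s \in wreath_S3_S2).
Proof.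
have im (b : 'I_2) : setact 'P%act [set x : 'I_2 * 'I_3 | x.1 == b]%SET s =
   [set s x | x in [set x : 'I_2 * 'I_3 | x.1 == b]]%SET by [].
have in_blocks (B : {set 'I_2 * 'I_3}) : B \in blocks ->
    forall x y, x \in B -> y \in B -> x.1 = y.1.
  by move=> /imsetP[b _ ->] x y; rewrite !inE => /eqP-> /eqP->.
apply: (iffP idP) => [hs|h].
  have sN := astabs_act _ hs.
  have eqb (t : {perm 'I_2 * 'I_3}) : t \in wreath_S3_S2 ->
      forall j j' : 'I_2 * 'I_3, j.1 = j'.1 -> (t j).1 = (t j').1.
    move=> ht j j' e; have tN := astabs_act [set x : 'I_2 * 'I_3 | x.1 == j.1]%SET ht.
    have : 'P^*%act [set x : 'I_2 * 'I_3 | x.1 == j.1]%SET t \in blocks.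
      by rewrite tN; apply/imsetP; exists j.1.
    by move/in_blocks; apply; apply: imset_f; rewrite inE ?e.
  move=> j j'; apply/eqP/eqP => [e|]; last exact: eqb.
  by have /eqb/(_ _ _ e) := groupVr hs; rewrite !permK.
rewrite inE; apply/andP; split; first by rewrite inE.
rewrite inE; apply/fintype.subsetP => B /imsetP[b _ ->]; rewrite !inE /= im.
apply/imsetP; exists (s (b, t0)).1 => //; apply/setP => x; rewrite inE.
apply/imsetP/eqP => [[y]|e]; first by rewrite inE => /eqP e ->; apply/eqP; rewrite h e.
exists (s^-1%g x); last by rewrite permKV.
by rewrite inE -[_ == b]/(_ == (b, t0).1) -h permKV e.
Qed.

Lemma wreath_groupP (g : lab_perm) : reflect
  (forall j j' : 'I_2 * 'I_3, ((g.2 j).1 == (g.2 j').1) = (j.1 == j'.1)) (g \in wreath_group).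
Proof.
by case: g => a s; rewrite finset.in_setX finset.in_setT; exact: wreathP.
Qed.

(** The group permutes the triples, hence respects the relations between the rays; this makes its
    action on the lattice independent of the coefficients chosen. *)
Lemma raycomb_act (a a' : lab -> int) g : g \in wreath_group ->
  raycomb a = raycomb a' -> raycomb (a \o lab_act g) = raycomb (a' \o lab_act g).
Proof.
move=> /wreath_groupP hg /raycomb_eqP h; apply/raycomb_eqP => i j j' jj' /=.
by apply: h; rewrite hg.
Qed.

Definition raycoord_row (l : lab) : 'rV[int]_6 := \row_j raycoord (delta_mx j 0) l.

(* The inverse makes [phi] a morphism: [(g * h)%g] applies [g] first. *)
Definition phi (g : lab_perm) : 'M[int]_6 := \sum_l ray (lab_act g^-1%g l) *m raycoord_row l.

Lemma raycoord_rowE l (v : 'cV[int]_6) : (raycoord_row l *m v) 0 0 = raycoord v l.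
Proof.
rewrite mxE; under eq_bigr do rewrite mxE.
have h (i : 'I_6) : raycoord (delta_mx i 0) l * v i 0 = raycoord (v i 0 *: delta_mx i 0) l.
  by elim/forall_lab: l; rewrite /raycoord /on_coords !mxE /=; ring.
under eq_bigr do rewrite h.
have hD : {morph raycoord^~ l : u w / u + w >-> u + w}.
  by move=> u w; elim/forall_lab: l {h}; rewrite /raycoord /on_coords !mxE /=; ring.
have h0 : raycoord 0 l = 0.
  by elim/forall_lab: l {h hD}; rewrite /raycoord /on_coords !mxE.
rewrite -(big_morph (raycoord^~ l) hD h0) [in RHS](matrix_sum_delta v).
by congr (raycoord _ l); apply: eq_bigr => i _; rewrite big_ord1.
Qed.

Lemma phi_raycomb g (a : lab -> int) : g \in wreath_group ->
  phi g *m raycomb a = raycomb (a \o lab_act g).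
Proof.
move=> hg; rewrite -(raycomb_act hg (raycoordK (raycomb a))).
rewrite /phi mulmx_suml /raycomb (reindex_inj (can_inj (lab_actK g))).
apply: eq_bigr => l _ /=; rewrite lab_actK -mulmxA [raycoord_row _ *m _]mx11_scalar.
by rewrite raycoord_rowE -mul_mx_scalar.
Qed.

Lemma phi_ray g l : g \in wreath_group -> phi g *m ray l = ray (lab_act g^-1%g l).
Proof.
move=> hg; rewrite ray_raycomb phi_raycomb // [RHS]ray_raycomb; apply: eq_raycomb => k /=.
by rewrite (can2_eq (lab_actK g) (lab_actVK g)).
Qed.

Lemma phiM : {in wreath_group &, forall g h, phi (g * h)%g = phi g *m phi h}.
Proof.
move=> g h hg hh; apply: eq_mx_ray => l.
by rewrite -mulmxA !phi_ray ?groupM // invMg lab_actM.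
Qed.

Lemma phi1 : phi 1%g = 1%:M.
Proof. by apply: eq_mx_ray => l; rewrite phi_ray ?group1 // invg1 lab_act1 mul1mx. Qed.

Lemma phi_inj : {in wreath_group &, injective phi}.
Proof.
move=> g h hg hh e; apply: invg_inj; apply: lab_act_inj => l; apply: ray_inj.
by rewrite -!phi_ray // e.
Qed.

Lemma phi_unit g : g \in wreath_group -> phi g \in unitmx.
Proof.
by move=> hg; case: (@mulmx1_unit _ _ (phi g) (phi g^-1%g));
   rewrite // -phiM ?groupV // mulgV phi1.
Qed.

Lemma phiV g : g \in wreath_group -> phi g^-1%g = invmx (phi g).
Proof.
move=> hg; apply: (can_inj (mulKmx (phi_unit hg))).
by rewrite mulmxV ?phi_unit // -phiM ?groupV // mulgV phi1.
Qed.

(** Compares two values of [C] through the positive lower bounds, which are the ones [C_raycomb_ge]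
    describes. *)
Lemma eq_int_ge (x y : int) : 0 <= x -> 0 <= y ->
  (forall k, 0 < k -> k <= x <-> k <= y) -> x = y.
Proof.
move=> x0 y0 h.
have hx : 0 < x -> x <= y by move=> xp; apply/(h x xp).
have hy : 0 < y -> y <= x by move=> yp; apply/(h y yp).
lia.
Qed.

Lemma C_ge0 v : 0 <= C v.
Proof. by rewrite -(raycoordK v) C_raycomb; lia. Qed.

Lemma linear_symmetry_phi g : g \in wreath_group -> linear_symmetry (phi g).
Proof.
move=> hg; split=> [|v]; first exact: phi_unit.
rewrite -(raycoordK v) (phi_raycomb _ hg); move: (raycoord v) => a.
apply: eq_int_ge; [exact: C_ge0|exact: C_ge0|] => k k0.
have hag := C_raycomb_ge (a \o lab_act g) k0; have ha := C_raycomb_ge a k0.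
move/wreath_groupP in hg; split=> [/hag h|/ha h]; [apply/ha|apply/hag] => i j j' jj'.
  have := h ((g.1)^-1%g i) ((g.2)^-1%g j) ((g.2)^-1%g j').
  by rewrite /= !permKV; apply; rewrite -hg !permKV.
by apply: h; rewrite hg.
Qed.

Lemma linear_symmetryP : linear_symmetry = phi @` [set g | g \in wreath_group].
Proof.
apply/seteqP; split=> [F hF|_ [g hg <-]]; last exact: linear_symmetry_phi.
have [uF CF] := hF.
have /choice[p hp] := linear_symmetry_ray hF.
have p_inj : injective p.
  by move=> k l e; apply/ray_inj/(can_inj (mulKmx uF)); rewrite !hp e.
pose q := perm p_inj; have hq l : F *m ray l = ray (q l) by rewrite permE.
pose hub (l : lab) : int := if l is inl _ then 1 else 0.
pose block (b : 'I_2) (l : lab) : int := if l is inr j then (j.1 == b)%:R else 0.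
have hit i (j j' : 'I_2 * 'I_3) : j.1 != j'.1 ->
    1 <= hub (q^-1%g (inl i)) + hub (q^-1%g (inr j)) + hub (q^-1%g (inr j')).
  move=> jj'; have : 2 <= C (raycomb (hub \o q^-1%g)).
    by rewrite -(raycomb_act_perm _ hq) CF C_raycomb.
  by move/C_raycomb_ge => /(_ isT i j j' jj') /=; lia.
(* By [hit], the images of c and f meet every triple. If one of them lay in a block, each group
   would have a label outside both images, because a block has three elements, and these labels
   would form a triple that misses both. *)
have /choice[s hs] : forall i : 'I_2, exists k : 'I_2, q (inl i) = inl k.
  move=> i; case e: (q (inl i)) => [k|j0]; first by exists k.
  have [i' ii'] := exists_ord2_neq i.
  have ei' l : hub (q^-1%g l) = ((l == q (inl i)) || (l == q (inl i')))%:R.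
    have el x : (l == q x) = (q^-1%g l == x).
      by apply/eqP/eqP => [->|<-]; rewrite ?permK ?permKV.
    rewrite !el; case: (q^-1%g l) => [m|//].
    by elim/forall_I2: i ii' {e el} => ii'; elim/forall_I2: i' ii' => // _; elim/forall_I2: m.
  have [i0 hi0] : exists i0, inl i0 != q (inl i').
    case: (q (inl i')) => [k|?]; last by exists b0.
    by have [z zk] := exists_ord2_neq k; exists z; apply: contraNneq zk => -[->].
  have av b : exists2 j : 'I_2 * 'I_3, j.1 = b & inr j != q (inl i') /\ j != j0.
    have [z [z1 z2]] := exists_ord3_neq (if q (inl i') is inr k then k.2 else t0) j0.2.
    exists (b, z) => //; split; last by apply: contraNneq z2 => <-.
    by case: (q (inl i')) z1 => [//|k] z1; apply: contraNneq z1 => -[<-].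
  have [[j1 e1 [n1 n2]] [j2 e2 [n3 n4]]] := (av b0, av b1).
  have := hit i0 j1 j2; rewrite e1 e2 => /(_ isT).
  have inr_eq (k k' : 'I_2 * 'I_3) : (inr k == inr k' :> lab) = (k == k') by [].
  by rewrite !ei' e (negPf hi0) (negPf n1) (negPf n3) !inr_eq (negPf n2) (negPf n4).
have s_inj : injective s by move=> i k e; have := hs i; rewrite e -hs => /perm_inj[].
have qinl i : exists i', q (inl i') = inl i.
  by exists ((perm s_inj)^-1%g i); rewrite hs -[s _](permE s_inj) permKV.
have /choice[t ht] : forall j : 'I_2 * 'I_3, exists k : 'I_2 * 'I_3, q (inr j) = inr k.
  move=> j; case e: (q (inr j)) => [k|j0]; last by exists j0.
  by have [i'] := qinl k; rewrite -e => /perm_inj.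
have t_inj : injective t by move=> i k e; have := ht i; rewrite e -ht => /perm_inj[].
pose g : lab_perm := (perm s_inj, perm t_inj).
have qE l : q l = lab_act g l by case: l => ?; rewrite ?hs ?ht /= permE.
have gG : g \in wreath_group.
  have qVr j : q^-1%g (inr (t j)) = inr j by rewrite -ht permK.
  (* [hub] and [block j.1] both represent b. If [t j] and [t j'] were in different blocks, the form
     of the triple [b0], [t j], [t j'] would be 1 on one image and 2 on the other, although the
     images coincide. *)
  have tE j j' : j.1 = j'.1 -> (t j).1 = (t j').1.
    move=> e; apply/eqP; apply: contraT => ne.
    have /(raycomb_eqP _ _)/(_ b0 _ _ ne) /=
      : raycomb (hub \o q^-1%g) = raycomb (block j.1 \o q^-1%g).
      rewrite -!(raycomb_act_perm _ hq); congr (F *m _); apply/raycomb_eqP => i k k' /=.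
      by elim/forall_I2: (j.1); elim/forall_I2: k.1; elim/forall_I2: k'.1.
    have [i' <-] := qinl b0.
    by rewrite permK !qVr /= e eqxx.
  apply/wreath_groupP => j j'; rewrite !permE; apply/eqP/eqP => [e|/tE//].
  apply/eqP; apply: contraT => ne.
  have [b hb] := exists_ord2_neq (t j).1.
  (* [k] is sent to the other block, yet it lies in the block of [j] or of [j']. *)
  pose k := (perm t_inj)^-1%g (b, t0).
  have tk : t k = (b, t0) by rewrite -[t k](permE t_inj) permKV.
  have : (k.1 == j.1) || (k.1 == j'.1).
    by move: ne; elim/forall_I2: (j.1); elim/forall_I2: (j'.1); elim/forall_I2: (k.1).
  by case/orP => /eqP/tE; rewrite tk -?e /= => ebb; rewrite ebb eqxx in hb.
exists g^-1%g; first exact: groupVr.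
by apply: eq_mx_ray => l; rewrite phi_ray ?groupV // invgK hq qE.
Qed.

(** * Orders and generators *)

Lemma card_eq_finset (T : finType) (x0 : T) (A : {set T}) :
  ([set x | x \in A] #= `I_#|A|)%card.
Proof.
rewrite card_eq_sym.
have -> : [set x | x \in A] = nth x0 (enum A) @` `I_#|A|.
  apply/seteqP; split=> [x /= xA|_ [k /= hk <-]].
    by exists (index x (enum A)); rewrite /= ?nth_index ?mem_enum // cardE index_mem mem_enum.
  by rewrite -mem_enum mem_nth -?cardE.
rewrite card_eq_sym; apply: inj_card_eq => i j; rewrite !inE /= !cardE => hi hj /eqP.
by rewrite nth_uniq ?enum_uniq // => /eqP.
Qed.

(** An element amounts to a permutation of the blocks together with one permutation of 'I_3 for each
    block, whence 2 * 6 ^ 2. *)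
Lemma card_wreath : #|wreath_S3_S2| = 72%N.
Proof.
pose f (z : 'S_2 * {ffun 'I_2 -> 'S_3}) (j : 'I_2 * 'I_3) := (z.1 j.1, z.2 j.1 j.2).
have f_inj z : injective (f z).
  by move=> [b x] [b' x'] [/perm_inj <- /perm_inj <-].
pose F z := perm (f_inj z).
have F_inj : injective F.
  move=> [p1 p2] [q1 q2] /permP e.
  have {}e b x : p1 b = q1 b /\ p2 b x = q2 b x by have := e (b, x); rewrite !permE => -[].
  congr pair; first by apply/permP => b; have [] := e b t0.
  by apply/ffunP => b; apply/permP => x; have [] := e b x.
have -> : wreath_S3_S2 = F @: [set: 'S_2 * {ffun 'I_2 -> 'S_3}]%SET :> {set _}.
  apply/setP => s; apply/wreathP/imsetP => [hs|[z _ ->] j j']; last first.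
    by rewrite !permE (inj_eq perm_inj).
  pose p b := (s (b, t0)).1.
  have p_inj : injective p by move=> b b' /eqP; rewrite hs => /eqP.
  pose q b x := (s (b, x)).2.
  have sE b x : s (b, x) = (p b, q b x).
    by rewrite [LHS]surjective_pairing; congr pair; apply/eqP; rewrite hs.
  have q_inj b : injective (q b).
    by move=> x x' e; have /perm_inj[] : s (b, x) = s (b, x') by rewrite !sE e.
  exists (perm p_inj, [ffun b => perm (q_inj b)]); first by rewrite finset.in_setT.
  by apply/permP => -[b x]; rewrite permE /f /= ffunE !permE sE.
by rewrite card_imset // cardsT card_prod card_ffun !card_Sn card_ord.
Qed.

Lemma card_wreath_group : #|wreath_group| = 144%N.
Proof. by rewrite cardsX cardsT card_wreath card_Sn. Qed.

Definition lab_code (l : lab) : nat :=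
  match l with inl i => i | inr (b, x) => 2 + 3 * b + x end.

(** Permutations are given by lists of codes so that relations between the generators are settled by
    evaluation on the eight labels. *)
Definition relabel (s : seq nat) (l : lab) : lab :=
  nth (inl b0) [:: inl b0; inl b1; inr (b0, t0); inr (b0, t1); inr (b0, t2);
    inr (b1, t0); inr (b1, t1); inr (b1, t2)] (nth 0%N s (lab_code l)).

(** Being an involution gives invertibility and makes the inverse in [phi] immaterial; it applies to
    S, T, U and X alike. *)
Lemma linear_symmetry_involution (f : 'cV[int]_6 -> 'cV[int]_6) s : linear f ->
  involutive f -> (forall v, C (f v) = C v) -> (forall l, f (ray l) = ray (relabel s l)) ->
  exists2 g, g \in wreath_group & phi g = matrix_of f /\ lab_act g =1 relabel s.
Proof.
move=> lf ff Cf fray.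
have hf : linear_symmetry (matrix_of f).
  split=> [|v]; last by rewrite matrix_ofE.
  have : matrix_of f *m matrix_of f = 1%:M.
    by apply: eq_mx_ray => l; rewrite -mulmxA !(matrix_ofE _ lf) ff mul1mx.
  by case/mulmx1_unit.
move: hf; rewrite linear_symmetryP => -[g /= hg e]; exists g => //; split=> // l.
have h k : lab_act g^-1%g k = relabel s k.
  by apply: ray_inj; rewrite -fray -phi_ray // e matrix_ofE.
have rr k : relabel s (relabel s k) = k by apply: ray_inj; rewrite -!fray ff.
have e' : relabel s (lab_act g l) = l by rewrite -h lab_actK.
by rewrite -[LHS]rr e'.
Qed.

(* The permutations of c, f, g1, e2, d1, g2, e1, d2, numbered from 0 in this order,
   induced by S, T, U and X. *)
Definition labels_S := [:: 0; 1; 5; 6; 7; 2; 3; 4]%N.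
Definition labels_T := [:: 1; 0; 6; 5; 7; 3; 2; 4]%N.
Definition labels_U := [:: 0; 1; 6; 7; 5; 4; 2; 3]%N.
Definition labels_X := [:: 0; 1; 2; 3; 4; 6; 5; 7]%N.

Lemma symS_elt : exists2 g, g \in wreath_group &
  phi g = matrix_of symS /\ lab_act g =1 relabel labels_S.
Proof.
apply: (linear_symmetry_involution symS_linear) => [v|v|].
- by apply: vec6P; rewrite /symS /on_coords !mxE /=; ring.
- by rewrite !C_lr_count /symS /on_coords !mxE /= /lr_count; lia.
- by elim/forall_lab; apply: vec6P; rewrite /symS /on_coords !mxE.
Qed.

Lemma symT_elt : exists2 g, g \in wreath_group &
  phi g = matrix_of symT /\ lab_act g =1 relabel labels_T.
Proof.
apply: (linear_symmetry_involution symT_linear) => [v|v|].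
- by apply: vec6P; rewrite /symT /on_coords !mxE /=; ring.
- by rewrite !C_lr_count /symT /on_coords !mxE /= /lr_count; lia.
- by elim/forall_lab; apply: vec6P; rewrite /symT /on_coords !mxE.
Qed.

Lemma symU_elt : exists2 g, g \in wreath_group &
  phi g = matrix_of symU /\ lab_act g =1 relabel labels_U.
Proof.
apply: (linear_symmetry_involution symU_linear) => [v|v|].
- by apply: vec6P; rewrite /symU /on_coords !mxE /=; ring.
- by rewrite !C_lr_count /symU /on_coords !mxE /= /lr_count; lia.
- by elim/forall_lab; apply: vec6P; rewrite /symU /on_coords !mxE.
Qed.

Lemma symX_elt : exists2 g, g \in wreath_group &
  phi g = matrix_of symX /\ lab_act g =1 relabel labels_X.
Proof.
apply: (linear_symmetry_involution symX_linear) => [v|v|].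
- by apply: vec6P; rewrite /symX /on_coords !mxE /=; ring.
- by rewrite !C_lr_count /symX /on_coords !mxE /= /lr_count; lia.
- by elim/forall_lab; apply: vec6P; rewrite /symX /on_coords !mxE.
Qed.

Lemma GL_subgroup_phi (A : {group lab_perm}) : A \subset wreath_group ->
  GL_subgroup (phi @` [set g | g \in A]).
Proof.
move=> /fintype.subsetP sA; split.
- by move=> _ [g /= /sA hg <-]; exact: phi_unit.
- by exists 1%g; [exact: group1|exact: phi1].
- move=> _ _ [g /= hg <-] [h /= hh <-]; exists (g * h)%g; first exact: groupM.
  by rewrite phiM ?sA.
- move=> _ [g /= hg <-]; exists g^-1%g; first by rewrite /= groupV.
  by rewrite phiV ?sA.
Qed.

(** [M] may be any set between the image of [A] and that of the group it generates, so that it can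
    contain all of [known_symmetries]. *)
Lemma gen_GL_phi (A : {set lab_perm}) (M : set 'M[int]_6) : A \subset wreath_group ->
  phi @` [set g | g \in A] `<=` M -> M `<=` phi @` [set g | g \in <<A>>%g] ->
  gen_GL M = phi @` [set g | g \in <<A>>%g].
Proof.
move=> sA AM MA; have sgA : <<A>>%g \subset wreath_group by rewrite gen_subG.
apply/seteqP; split.
  exact: (smallest_sub (GL_subgroup_phi sgA)).
move=> _ [g /= hg <-] H [[Hu H1 HM HV] MH].
have [n [c cA ->]] := gen_prodgP hg.
suff [] : H (phi (\prod_i c i)%g) /\ (\prod_i c i)%g \in wreath_group by [].
elim/big_ind: _ => [|x y [Hx xW] [Hy yW]|i _].
- by split; [rewrite phi1|exact: group1].
- by split; [rewrite phiM //; apply: HM|exact: groupM].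
- split; last exact: (fintype.subsetP sA).
  by apply/MH/AM; exists (c i); first exact: cA.
Qed.

(** The group is S_3 x S_2: [s * u] has order 3 and is inverted by [s], and [t] is a central
    involution. *)
Lemma card_known_elements (s t u : lab_perm) : lab_act s =1 relabel labels_S ->
  lab_act t =1 relabel labels_T -> lab_act u =1 relabel labels_U ->
  #|<<[set s; t; u]>>%g|%SET = 12%N.
Proof.
move=> sE tE uE.
have ss : (s * s = 1)%g.
  by apply: lab_act_inj => l; rewrite lab_actM lab_act1 !sE; elim/forall_lab: l.
have tt : (t * t = 1)%g.
  by apply: lab_act_inj => l; rewrite lab_actM lab_act1 !tE; elim/forall_lab: l.
have ts : (t * s = s * t)%g.
  by apply: lab_act_inj => l; rewrite !lab_actM !(tE, sE); elim/forall_lab: l.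
have tu : (t * u = u * t)%g.
  by apply: lab_act_inj => l; rewrite !lab_actM !(tE, uE); elim/forall_lab: l.
pose r := (s * u)%g.
have rE l : lab_act r l = relabel labels_U (relabel labels_S l) by rewrite lab_actM uE sE.
have r3 : (r ^+ 3 = 1)%g.
  by apply: lab_act_inj => l; rewrite !expgS expg0 mulg1 !lab_actM lab_act1 !(sE, uE); elim/forall_lab: l.
have rs : (r ^ s = r^-1)%g.
  have uu : (u * u = 1)%g.
    by apply: lab_act_inj => l; rewrite lab_actM lab_act1 !uE; elim/forall_lab: l.
  have sV : (s^-1 = s)%g by apply/eqP; rewrite eq_invg_mul ss.
  have uV : (u^-1 = u)%g by apply/eqP; rewrite eq_invg_mul uu.
  by rewrite /r /conjg invMg sV uV !mulgA ss mul1g.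
have ne (g : lab_perm) l : lab_act g l != l -> g != 1%g.
  by apply: contraNneq => ->; rewrite lab_act1.
have or : #[r]%g = 3.
  by apply: nt_prime_order r3 _ => //; apply: (ne _ (inr (b0, t0))); rewrite rE.
have os : #[s]%g = 2.
  by apply: (@nt_prime_order _ 2) => //; apply: (ne _ (inr (b0, t0))); rewrite sE.
have ot : #[t]%g = 2.
  by apply: (@nt_prime_order _ 2) => //; apply: (ne _ (inr (b0, t0))); rewrite tE.
pose K := (<[r]> <*> <[s]>)%G.
have cK : #|K| = 6%N.
  rewrite /= norm_joinEr; last by rewrite norms_cycle rs groupV cycle_id.
  by rewrite coprime_cardMg -!orderE or os.
have eH : <<[set s; t; u]>>%g%SET = (K <*> <[t]>)%g.
  apply/eqP; rewrite finset.eqEsubset gen_subG !join_subG !cycle_subG; apply/andP; split.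
    apply/fintype.subsetP => g; rewrite !inE -!orbA => /or3P[]/eqP->.
    - by rewrite mem_gen // !inE mem_gen // !inE cycle_id ?orbT.
    - by rewrite mem_gen // !inE cycle_id ?orbT.
    have -> : u = (s * r)%g by rewrite /r mulgA ss mul1g.
    by rewrite groupM // mem_gen // !inE mem_gen // !inE cycle_id ?orbT.
  by rewrite groupM ?mem_gen // !inE eqxx ?orbT.
(* [t] exchanges c and f, which [K] fixes. *)
have TI : (K :&: <[t]>)%g = 1%g.
  rewrite finset.setIC; apply: prime_TIg; first by rewrite -orderE ot.
  rewrite cycle_subG; apply: contraL (isT) => tK.
  have fixK g : g \in K -> g.1 = 1%g.
    have /fintype.subsetP sK : K \subset setX_group 1%G [set: {perm 'I_2 * 'I_3}]%G.
      rewrite join_subG !cycle_subG.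
      have h (a : lab_perm) : (forall i, lab_act a (inl i) = inl i) ->
          a \in setX_group 1%G [set: {perm 'I_2 * 'I_3}]%G.
        case: a => a a' ha; rewrite finset.in_setX finset.in_setT andbT; apply/set1gP/permP => i.
        by have [->] := ha i; rewrite perm1.
      by rewrite !h // => i; rewrite ?rE ?sE; elim/forall_I2: i.
    by case: g => a a' /sK; rewrite finset.in_setX => /andP[/set1gP].
  by have := tE (inl b0); rewrite /lab_act fixK // perm1.
rewrite eH cent_joinEr ?TI_cardMg ?cK -?orderE ?ot //.
rewrite cycle_subG; apply/centP => g; rewrite /= => gK.
have /fintype.subsetP sK : K \subset 'C[t].
  rewrite join_subG !cycle_subG; apply/andP; split; apply/cent1P.
    by rewrite /commute /r mulgA ts -!mulgA tu.
  by rewrite /commute ts.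
by have /cent1P := sK _ gK.
Qed.

Definition swap (j j' : 'I_2 * 'I_3) : lab_perm := (1%g, tperm j j').

Lemma swapJ j j' (g : lab_perm) : (swap j j' ^ g)%g = swap (g.2 j) (g.2 j').
Proof.
rewrite /swap /conjg /mulg /= /mul_pair /=; congr pair; first by rewrite mul1g mulVg.
exact: tpermJ.
Qed.

(** Induction on the number of moved points: following [p] by the transposition of [p j] and [j]
    fixes [j] and moves no new point. *)
Lemma block_perm_generated (L : {group lab_perm}) (p : {perm 'I_2 * 'I_3}) :
  (forall j j', j.1 = j'.1 -> swap j j' \in L) ->
  (forall j, (p j).1 = j.1) -> ((1%g, p) : lab_perm) \in L.
Proof.
move=> hL; have [n] := ubnP #|[set j | p j != j]|%SET; elim: n p => // n IH p lt_n hp.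
have [->|/eqP] := eqVneq p 1%g; first exact: group1.
move/permP/existsNP => [j /eqP]; rewrite perm1 => pj.
pose p' := (p * tperm (p j) j)%g.
have -> : ((1%g, p) : lab_perm) = (((1%g, p') : lab_perm) * swap (p j) j)%g.
  by rewrite /swap /mulg /= /mul_pair /=; congr pair; rewrite ?mulg1 // /p' -mulgA tperm2 mulg1.
apply: groupM; last exact: hL.
apply: IH => [|k]; last first.
  by rewrite /p' permM; case: tpermP => [e|e|_ _]; [rewrite -[LHS]hp -e hp|rewrite hp -e hp|exact: hp].
rewrite ltnS in lt_n; apply: leq_trans lt_n; apply: proper_card; apply/properP; split.
  apply/fintype.subsetP => k; rewrite !inE /p' permM; apply: contraNneq => pk.
  rewrite pk tpermD //; last by apply: contraNneq pj => ->; apply/eqP.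
  by apply: contraNneq pj => e; apply/eqP/(@perm_inj _ p); rewrite e pk.
by exists j; rewrite !inE ?pj // /p' permM tpermL eqxx.
Qed.

(** [x] is the transposition of g2 and e1, and its conjugates under [s] and [u] are all the
    transpositions inside the blocks. There remain the exchange of the blocks, done by [s], and that
    of c and f, done by [t]. *)
Lemma wreath_group_generated (s t u x : lab_perm) :
  s \in wreath_group -> t \in wreath_group -> u \in wreath_group -> x \in wreath_group ->
  lab_act s =1 relabel labels_S -> lab_act t =1 relabel labels_T ->
  lab_act u =1 relabel labels_U -> lab_act x =1 relabel labels_X ->
  <<[set s; t; u; x]>>%g%SET = wreath_group.
Proof.
move=> hs ht hu hx sE tE uE xE; pose L := <<[set s; t; u; x]>>%G%SET; rewrite -[LHS]/(L : {set _}).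
have [sL tL uL xL] : [/\ s \in L, t \in L, u \in L & x \in L].
  by split; apply: mem_gen; rewrite !inE eqxx ?orbT.
have s2 j : inr (s.2 j) = relabel labels_S (inr j) by rewrite -sE.
have u2 j : inr (u.2 j) = relabel labels_U (inr j) by rewrite -uE.
have x1 : x = swap (b1, t0) (b1, t1).
  apply: lab_act_inj => l; rewrite xE; elim/forall_lab: l => /=; rewrite ?perm1 //;
  by rewrite permE.
have hL : forall j j', j.1 = j'.1 -> swap j j' \in L.
  have step g j j' k k' : g \in L -> inr (g.2 j) = inr k :> lab -> inr (g.2 j') = inr k' :> lab ->
      swap j j' \in L -> swap k k' \in L.
    by move=> gL [<-] [<-] hjj'; rewrite -swapJ groupJ.
  have swC j j' : swap j j' \in L -> swap j' j \in L by rewrite /swap tpermC.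
  have sw1 j : swap j j \in L by rewrite /swap tperm1 group1.
  have h101 : swap (b1, t0) (b1, t1) \in L by rewrite -x1.
  have h001 : swap (b0, t0) (b0, t1) \in L by apply: (step s) h101; rewrite ?s2.
  have h020 : swap (b0, t2) (b0, t0) \in L by apply: (step u) h101; rewrite ?u2.
  have h112 : swap (b1, t1) (b1, t2) \in L by apply: (step u) h001; rewrite ?u2.
  have h120 : swap (b1, t2) (b1, t0) \in L by apply: (step s) h020; rewrite ?s2.
  have h012 : swap (b0, t1) (b0, t2) \in L by apply: (step s) h112; rewrite ?s2.
  move=> [b y] [b' y'] /= <- {b'}.
  elim/forall_I2: b; elim/forall_I3: y; elim/forall_I3: y';
    do ?[exact: sw1 | assumption | by apply: swC].
have fix1 (g : lab_perm) : g \in wreath_group -> g.1 = 1%g -> (g.2 (b0, t0)).1 = b0 -> g \in L.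
  case: g => [g1 g2] /wreath_groupP /= hg -> e; apply: block_perm_generated hL _ => j.
  have := hg j (b0, t0); rewrite e /=.
  by elim/forall_I2: (j.1); elim/forall_I2: (g2 j).1.
have fix2 (g : lab_perm) : g \in wreath_group -> g.1 = 1%g -> g \in L.
  move=> hg g1; case e : ((g.2 (b0, t0)).1 == b0); first by apply: fix1 => //; apply/eqP.
  suff : (g * s)%g \in L by rewrite groupMr.
  have s1 : s.1 = 1%g.
    by apply/permP => i; have := sE (inl i); rewrite perm1; elim/forall_I2: i => -[].
  apply: fix1; first exact: groupM.
    by rewrite /= g1 s1 mulg1.
  rewrite /= permM; have := s2 (g.2 (b0, t0)).
  case: (g.2 (b0, t0)) e => b y /=; elim/forall_I2: b => // _.
  by elim/forall_I3: y => -[->].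
apply/eqP; rewrite finset.eqEsubset gen_subG; apply/andP; split.
  apply/fintype.subsetP => g gA.
  have : [|| g == s, g == t, g == u | g == x] by move: gA; rewrite !inE -!orbA.
  by case/or4P => /eqP->.
apply/fintype.subsetP => g hg; case e : (g.1 b0 == b0).
  apply: fix2 => //; apply/permP => i; rewrite perm1; elim/forall_I2: i; first exact/eqP.
  have : g.1 b1 != g.1 b0 by rewrite (inj_eq perm_inj).
  by move/eqP: e => ->; elim/forall_I2: (g.1 b1).
suff : (g * t)%g \in L by rewrite groupMr.
apply: fix2; first exact: groupM.
have tt i : inl (t.1 i) = relabel labels_T (inl i) by rewrite -tE.
have [t01 t10] : t.1 b0 = b1 /\ t.1 b1 = b0 by have := (tt b0, tt b1) => -[[->] [->]].
have g0 : g.1 b0 = b1 by elim/forall_I2: (g.1 b0) e.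
have g1 : g.1 b1 = b0.
  have : g.1 b1 != g.1 b0 by rewrite (inj_eq perm_inj).
  by rewrite g0; elim/forall_I2: (g.1 b1).
apply/permP => i; rewrite /= permM perm1.
by elim/forall_I2: i; rewrite ?g0 ?g1.
Qed.

(** * The chambers *)

(* [None] stands for b. *)
Definition ray_or_b (o : option lab) : 'cV[int]_6 := if o is Some l then ray l else ray_b.

Definition lab_or_b_act (g : lab_perm) : option lab -> option lab := omap (lab_act g).

(** Indexing generators by a set of labels instead of a list makes the image under [phi g] the cone
    on the preimage of that set. *)
Definition facet_cone (R : realType) (D : {pred option lab}) : set 'cV[R]_6 :=
  [set x | exists u : option lab -> R, [/\ forall o, 0 <= u o,
     forall o, o \notin D -> u o = 0 & x = \sum_o u o *: Defs.realmx R (ray_or_b o)]].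

Arguments facet_cone : clear implicits.

Lemma eq_facet_cone (R : realType) (D D' : {pred option lab}) :
  D =i D' -> facet_cone R D = facet_cone R D'.
Proof.
by move=> e; apply/seteqP; split=> x [u [u0 uD ->]]; exists u; split=> // o;
  rewrite -?e ?[_ \notin _]e => h; apply: uD; rewrite ?e // -?e.
Qed.

Lemma cone_facet_cone (R : realType) (s : seq (option lab)) : uniq s ->
  @cone R (map ray_or_b s) = facet_cone R (mem s).
Proof.
move=> us; apply/seteqP; split=> x.
  case=> t [t0 ->].
  have sz : size (map ray_or_b s) = size s by rewrite size_map.
  pose u o : R := if insub (index o s) is Some i then t i else 0.
  exists u; split=> [o|o os|].
  - by rewrite /u; case: insubP.
  - by rewrite /u insubF // sz index_mem; apply/negbTE.
  rewrite [RHS](bigID (mem s)) /= [X in _ + X]big1 ?addr0 => [|o os]; last first.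
    by rewrite /u insubF ?scale0r // sz index_mem; apply/negbTE.
  rewrite -big_uniq //= (big_nth None) big_mkord -sz.
  apply: eq_bigr => i _.
  have lt_i : (i < size s)%N by rewrite -sz.
  rewrite (nth_map None) //; congr (_ *: _).
  by rewrite /u index_uniq // valK.
case=> u [u0 us0 ->]; exists (fun i => u (nth None s i)); split=> [//|].
rewrite (bigID (mem s)) /= [X in _ + X]big1 ?addr0 => [|o os]; last by rewrite us0 ?scale0r.
rewrite -big_uniq //= (big_nth None) big_mkord size_map.
by apply: eq_bigr => i _; rewrite (nth_map None).
Qed.

Lemma phi_ray_or_b g o : g \in wreath_group ->
  phi g *m ray_or_b o = ray_or_b (lab_or_b_act g^-1%g o).
Proof.
move=> hg; case: o => [l|]; first exact: phi_ray.
(* b = c + f, whose coefficients only depend on the side of the sum type and are thus invariant. *)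
have -> : ray_or_b None = raycomb (fun l => if l is inl _ then 1 else 0).
  by rewrite raycombE; apply: vec6P; rewrite !mxE.
by rewrite phi_raycomb //; apply: eq_raycomb; case.
Qed.

Lemma chamber_image_facet_cone (R : realType) g (D : {pred option lab}) :
  g \in wreath_group ->
  chamber_image (phi g) (facet_cone R D) = facet_cone R (fun o => lab_or_b_act g o \in D).
Proof.
have act9K h : cancel (lab_or_b_act h) (lab_or_b_act h^-1%g) by case=> //= l; rewrite lab_actK.
have sub h (E : {pred option lab}) : h \in wreath_group ->
   chamber_image (phi h) (facet_cone R E) `<=` facet_cone R (fun o => lab_or_b_act h o \in E).
  move=> hh _ [_ [u [u0 uE ->]] <-]; exists (u \o lab_or_b_act h); split=> [o|o oE|] //=.
    exact: uE.
  rewrite mulmx_sumr [LHS](reindex_inj (can_inj (act9K h))); apply: eq_bigr => o _.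
  by rewrite -scalemxAr -map_mxM phi_ray_or_b // act9K.
move=> hg; apply/seteqP; split; first exact: sub.
move=> x hx; exists (Defs.realmx R (phi g^-1%g) *m x); last first.
  by rewrite mulmxA -map_mxM -phiM ?groupV // mulgV phi1 map_mx1 mul1mx.
(* The same inclusion for the inverse; the two preimages cancel. *)
have : facet_cone R (fun o => lab_or_b_act g^-1%g o \in (fun o => lab_or_b_act g o \in D))
    (Defs.realmx R (phi g^-1%g) *m x).
  by apply: sub; [rewrite groupV|exists x].
rewrite (@eq_facet_cone _ _ D) // => o.
by have := act9K g^-1%g o; rewrite invgK !unfold_in /= => ->.
Qed.

(* A chamber is generated by b and by all the other rays but one in each group. *)
Definition retained (i : 'I_2) (x y : 'I_3) : {pred option lab} :=
  fun o => o \notin [:: Some (inl i); Some (inr (b0, x)); Some (inr (b1, y))].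

Definition chamber_labels : seq (seq (option lab)) :=
  let b := None in let c := Some (inl b0) in let f := Some (inl b1) in
  let g1 := Some (inr (b0, t0)) in let e2 := Some (inr (b0, t1)) in
  let d1 := Some (inr (b0, t2)) in let g2 := Some (inr (b1, t0)) in
  let e1 := Some (inr (b1, t1)) in let d2 := Some (inr (b1, t2)) in
  [:: [:: b; c; d1; e2; d2; e1]; [:: b; c; d1; g1; d2; g2];
      [:: b; c; e2; g1; e1; g2]; [:: b; f; d1; e2; d2; e1];
      [:: b; f; d1; g1; d2; g2]; [:: b; f; e2; g1; e1; g2];
      [:: b; c; d1; g1; d2; e1]; [:: b; c; d1; e2; d2; g2];
      [:: b; c; d1; e2; e1; g2]; [:: b; c; e2; g1; d2; e1];
      [:: b; c; d1; g1; e1; g2]; [:: b; c; e2; g1; d2; g2];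
      [:: b; f; d1; g1; d2; e1]; [:: b; f; d1; e2; d2; g2];
      [:: b; f; d1; g1; e1; g2]; [:: b; f; e2; g1; d2; g2];
      [:: b; f; d1; e2; e1; g2]; [:: b; f; e2; g1; d2; e1]].

(** Every triple occurs once. The form of the omitted triple is minimal on its chamber, where it
    gives the polynomial of [C]. *)
Definition chamber_omits : seq ('I_2 * 'I_3 * 'I_3) :=
  [:: (b1, t0, t0); (b1, t1, t1); (b1, t2, t2); (b0, t0, t0); (b0, t1, t1); (b0, t2, t2);
      (b1, t1, t0); (b1, t0, t1); (b1, t0, t2); (b1, t2, t0); (b1, t1, t2); (b1, t2, t1);
      (b0, t1, t0); (b0, t0, t1); (b0, t1, t2); (b0, t2, t1); (b0, t0, t2); (b0, t2, t0)].

Lemma chamber_omits_labels (k : nat) : (k < 18)%N ->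
  let z := nth (b0, t0, t0) chamber_omits k in
  nth [::] chamber_rays k = map ray_or_b (nth [::] chamber_labels k) /\
  uniq (nth [::] chamber_labels k) /\
  nth [::] chamber_labels k =i retained z.1.1 z.1.2 z.2.
Proof.
do 18! [case: k => [_|k] /=; first by
  split=> //; split=> //; case=> [l|//]; elim/forall_lab: l].
by [].
Qed.

Lemma chamber_facet_cone (R : realType) (k : 'I_18) :
  let z := nth (b0, t0, t0) chamber_omits k in
  @chamber R k = facet_cone R (retained z.1.1 z.1.2 z.2).
Proof.
move=> z; rewrite /chamber; have [-> [us e]] := chamber_omits_labels (ltn_ord k).
by rewrite cone_facet_cone //; apply: eq_facet_cone.
Qed.

Lemma facet_cone_chamber (R : realType) i x y :
  exists k : 'I_18, @chamber R k = facet_cone R (retained i x y).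
Proof.
have h : (i, x, y) \in chamber_omits.
  by elim/forall_I2: i; elim/forall_I3: x; elim/forall_I3: y.
have lt_k : (index (i, x, y) chamber_omits < 18)%N by rewrite index_mem.
by exists (Ordinal lt_k); rewrite chamber_facet_cone /= nth_index.
Qed.

Lemma retained_act (g : lab_perm) i x y (a b c : lab) :
  lab_act g a = inl i -> lab_act g b = inr (b0, x) -> lab_act g c = inr (b1, y) ->
  (fun o => lab_or_b_act g o \in retained i x y) =i
  (fun o => o \notin [:: Some a; Some b; Some c] : bool).
Proof.
move=> ga gb gc o.
rewrite -[RHS]/(o \notin [:: Some a; Some b; Some c]) -[LHS]/(lab_or_b_act g o \notin
  [:: Some (inl i); Some (inr (b0, x)); Some (inr (b1, y))]) !inE -ga -gb -gc.
have e l : (lab_or_b_act g o == Some (lab_act g l)) = (o == Some l).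
  case: o => [k|//]; rewrite /= !(inj_eq Some_inj); apply: inj_eq; exact: can_inj (lab_actK g).
by rewrite !e.
Qed.

Lemma linear_symmetry_chamber (R : realType) F (k : 'I_18) : linear_symmetry F ->
  exists l : 'I_18, chamber_image F (@chamber R k) = @chamber R l.
Proof.
rewrite linear_symmetryP => -[g /= hg <-]; rewrite chamber_facet_cone chamber_image_facet_cone //.
case: (nth _ _ _) => -[i x] y /=.
have gV l : lab_act g (lab_act g^-1%g l) = l by rewrite lab_actVK.
rewrite (eq_facet_cone _ (retained_act (gV _) (gV _) (gV _))).
have /wreath_groupP/(_ (b0, x) (b1, y)) := groupVr hg.
rewrite /lab_act; case: ((g^-1%g).2 (b0, x)) => b x'; case: ((g^-1%g).2 (b1, y)) => b' y' /=.
elim/forall_I2: b; elim/forall_I2: b' => // _.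
  by have [l lE] := facet_cone_chamber R ((g.1)^-1%g i) x' y'; exists l; rewrite lE.
(* The blocks are exchanged, so the two omitted labels come in the opposite order. *)
have [l lE] := facet_cone_chamber R ((g.1)^-1%g i) y' x'; exists l; rewrite lE.
apply: eq_facet_cone => o; congr (~~ _); rewrite !inE; congr (_ || _); exact: orbC.
Qed.

Lemma chamber_transitive (R : realType) (k l : 'I_18) : exists F, linear_symmetry F /\
  chamber_image F (@chamber R k) = @chamber R l.
Proof.
rewrite !chamber_facet_cone; case: (nth _ _ k) => -[i x] y; case: (nth _ _ l) => -[i' x'] y' /=.
(* As images of cones are cones on preimages, [g] must carry the triple omitted by the target to the
   one omitted by the source. *)
pose p := (tperm (b0, x') (b0, x) * tperm (b1, y') (b1, y))%g.
pose g : lab_perm := (tperm i' i, p).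
have block (j j1 j2 : 'I_2 * 'I_3) : j1.1 = j2.1 -> (tperm j1 j2 j).1 = j.1.
  by move=> e; case: tpermP => // ->.
have hg : g \in wreath_group by apply/wreath_groupP => j j'; rewrite !permM !block.
exists (phi g); split; first exact: linear_symmetry_phi.
rewrite chamber_image_facet_cone //; apply: eq_facet_cone.
apply: retained_act; rewrite /= ?permM ?tpermL //.
  by rewrite tpermD.
by rewrite [tperm _ _ (b1, y')]tpermD // tpermL.
Qed.

Lemma symmetry_generators : exists s t u x : lab_perm,
  [/\ [/\ s \in wreath_group, t \in wreath_group, u \in wreath_group & x \in wreath_group],
   [/\ phi s = matrix_of symS, phi t = matrix_of symT, phi u = matrix_of symU &
       phi x = matrix_of symX],
   #|<<[set s; t; u]>>%g|%SET = 12%N & <<[set s; t; u; x]>>%g%SET = wreath_group].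
Proof.
have [[s hs [es sE]] [t ht [et tE]]] := (symS_elt, symT_elt).
have [[u hu [eu uE]] [x hx [ex xE]]] := (symU_elt, symX_elt).
exists s, t, u, x; split=> //; first exact: card_known_elements sE tE uE.
exact: wreath_group_generated.
Qed.

Lemma card_phi_image (A : {group lab_perm}) : A \subset wreath_group ->
  phi @` [set g | g \in A] #= `I_#|A|.
Proof.
move=> /fintype.subsetP sA; apply: card_eq_trans (card_eq_finset 1%g A).
by apply: inj_card_eq => g h; rewrite !in_setE => /= /sA hg /sA hh; apply: phi_inj.
Qed.

Theorem theorem1 (R : realType) :
  [/\ linear_symmetry #= `I_144,
      isog_GL (setX_group [set: 'S_2]%G wreath_S3_S2) linear_symmetry &
      (forall F, linear_symmetry F -> forall k : 'I_18,
         exists l : 'I_18, chamber_image F (@chamber R k) = @chamber R l) /\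
      (forall k l : 'I_18, exists F, linear_symmetry F /\
         chamber_image F (@chamber R k) = @chamber R l)] /\
  [/\ known_symmetries #= `I_12,
      linear_symmetry = gen_GL (known_symmetries `|` [set matrix_of symX]) &
      forall l1 l2 m1 m2 n1 n2 : int,
        let n3 := l1 + l2 + m1 + m2 - n1 - n2 in
        LRcoefz [tuple l1; l2; 0] [tuple m1; m2; 0] [tuple n1; n2; n3] =
        LRcoefz [tuple l1 + m1 - n2; l2 + m1 - n2; 0] [tuple n2; m2; 0]
          [tuple n1; m1; n3]].
Proof.
have [s [t [u [x [[hs ht hu hx] [es et eu ex] c12 gW]]]]] := symmetry_generators.
have sA : [set s; t; u]%SET \subset wreath_group.
  by rewrite !finset.subUset !finset.sub1set hs ht hu.
have sB : [set s; t; u; x]%SET \subset wreath_group by rewrite -gW subset_gen.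
have known : known_symmetries = phi @` [set g | g \in <<[set s; t; u]%SET>>%g].
  apply: gen_GL_phi => // [_ [g /= + <-]|_ [[]|]->].
  - by rewrite !inE -!orbA => /or3P[]/eqP->; [left; left|left; right|right].
  - by exists s => //=; rewrite mem_gen // !inE eqxx.
  - by exists t => //=; rewrite mem_gen // !inE eqxx ?orbT.
  - by exists u => //=; rewrite mem_gen // !inE eqxx ?orbT.
split; split.
- rewrite linear_symmetryP -card_wreath_group; exact: card_phi_image.
- by exists phi; split; [exact: phi_inj|exact: phiM|rewrite linear_symmetryP].
- split=> [F hF k|k l]; [exact: linear_symmetry_chamber|exact: chamber_transitive].
- by rewrite known -c12; apply: card_phi_image; rewrite gen_subG.
- rewrite linear_symmetryP -gW; apply/esym/gen_GL_phi => //.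
    move=> _ [g /= + <-]; rewrite !inE -!orbA => /or4P[]/eqP->; last by right.
    + left; rewrite known; exists s => //=; rewrite mem_gen // !inE eqxx //.
    + left; rewrite known; exists t => //=; rewrite mem_gen // !inE eqxx ?orbT //.
    + left; rewrite known; exists u => //=; rewrite mem_gen // !inE eqxx ?orbT //.
  move=> F [hF|->]; last by exists x => //=; rewrite mem_gen // !inE eqxx ?orbT.
  move: hF; rewrite known => -[g /= hg <-]; exists g => //=.
  by apply: (fintype.subsetP (genS _)) hg; apply: finset.subsetUl.
- move=> l1 l2 m1 m2 n1 n2 n3.
  have [_ CX] : linear_symmetry (matrix_of symX).
    by rewrite -ex; apply: linear_symmetry_phi.
  have := CX (vec6 l1 l2 m1 m2 n1 n2); rewrite (matrix_ofE _ symX_linear).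
  rewrite /symX /C /on_coords !mxE /=.
  rewrite -/n3; have -> : l1 + m1 - n2 + (l2 + m1 - n2) + n2 + m2 - n1 - m1 = n3.
    by rewrite /n3; ring.
  by move->.
Qed.
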